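(* Fix $h = 2\pi^2$. For a positive integer $N_t$ put $T=\sqrt{N_t h/4}$ and define, for $x\in[0,1]$, $$r_t(x) = \frac{xh}{\pi} \sum_{j=1}^{N_t} \frac{1}{\sqrt{jh}} \cdot \frac{e^{\sqrt{jh}-\sqrt{N_t h/4}}}{e^{2\sqrt{jh}-2\sqrt{N_t h/4}} + x}.$$ Assume the following bound holds for all sufficiently large $N_t$: for every $x\in[e^{4-2T},1]$, $$\left|\int_\Gamma f(u,x)\,\delta(u)\,du\right| < 12\, e^{-T},$$ where $f$, $\delta$ and $\Gamma$ are as described in the context. Then, as $N_t\to\infty$, uniformly for $x\in[0,1]$, $$|r_t(x)-\sqrt{x}\,| < 20\, e^{-\sqrt{N_t h/4}} = 20\, e^{-\pi\sqrt{N_t/2}}.$$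
   Context: Here $\sqrt{u}$ denotes the principal branch of the square root. For $u\in\mathbb{C}$ and $x\in(0,1]$, $f(u,x) = \frac{x}{\pi}\,\frac{1}{\sqrt{u}}\,\frac{e^{\sqrt{u}-T}}{e^{2(\sqrt{u}-T)}+x}$. The function $\delta(u)=\mu(u)-m(u)$, where $\mu(u)=-\tfrac12$ if $\operatorname{Im}u\ge 0$ and $\mu(u)=\tfrac12$ if $\operatorname{Im}u<0$, and $m(u) = -\tfrac{i}{2}\cot(\pi u/h)$. The contour $\Gamma$ is the positively oriented boundary of the rectangle $\{u: 1\le \operatorname{Re}u\le 4T^2+1,\ |\operatorname{Im}u|\le a\}$ with $a = 2\pi(T+\tfrac12\log x)$. *)

(* Defs.v *)
From Stdlib Require Import Reals.
From Coquelicot Require Import Coquelicot.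
Open Scope R_scope.

Definition h : R := 2 * PI ^ 2.

Definition Tt (Nt : nat) : R := sqrt (INR Nt * h / 4).

Definition r_t (Nt : nat) (x : R) : R :=
  x * h / PI *
  sum_n_m (fun j : nat =>
     / sqrt (INR j * h) *
     (exp (sqrt (INR j * h) - sqrt (INR Nt * h / 4)) /
      (exp (2 * sqrt (INR j * h) - 2 * sqrt (INR Nt * h / 4)) + x))) 1 Nt.

Local Open Scope C_scope.
Definition Cexp (z : C) : C := ((exp (Re z) * cos (Im z))%R, (exp (Re z) * sin (Im z))%R).

(* principal branch of the square root (branch cut on the negative reals,
   sqrt of a negative real r is i*sqrt|r|) *)
Definition Csqrt (z : C) : C :=
  (sqrt ((Cmod z + Re z) / 2),
   (if Rle_dec 0 (Im z) then 1 else -1) * sqrt ((Cmod z - Re z) / 2))%R.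

Definition Ccos (w : C) : C := (Cexp (Ci * w) + Cexp (- (Ci * w))) / 2.
Definition Csin (w : C) : C := (Cexp (Ci * w) - Cexp (- (Ci * w))) / (2 * Ci).
Definition Ccot (w : C) : C := Ccos w / Csin w.

Definition f (Nt : nat) (u : C) (x : R) : C :=
  RtoC (x / PI) * / Csqrt u *
  (Cexp (Csqrt u - RtoC (Tt Nt)) / (Cexp (2 * (Csqrt u - RtoC (Tt Nt))) + RtoC x)).

Definition mu (u : C) : C := if Rle_dec 0 (Im u) then RtoC (-1/2) else RtoC (1/2).
Definition m (u : C) : C := - (Ci / 2) * Ccot (RtoC PI * u / RtoC h).
Definition delta (u : C) : C := mu u - m u.

(* contour integral over the positively oriented boundary of the rectangle
   {A <= Re u <= B, |Im u| <= a}: bottom edge (left to right), right edge (upwards),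
   top edge (right to left), left edge (downwards). *)
Definition rect_integral (g : C -> C) (A B a : R) : C :=
  @RInt C_R_CompleteNormedModule (fun t => g (t, (- a)%R)) A B
  + Ci * @RInt C_R_CompleteNormedModule (fun s => g (B, s)) (- a) a
  - @RInt C_R_CompleteNormedModule (fun t => g (t, a)) A B
  - Ci * @RInt C_R_CompleteNormedModule (fun s => g (A, s)) (- a) a.

Definition Gamma_integral (Nt : nat) (x : R) : C :=
  rect_integral (fun u => (f Nt u x * delta u)%C) 1 (4 * Tt Nt ^ 2 + 1)
    (2 * PI * (Tt Nt + / 2 * ln x)).

(* Main.v *)
(** Write [L = T + ln x / 2], so that the condition on [x] says [L >= 2].  The residue
    theorem evaluates the contour integral of [f delta]: the term [mu] contributes the
    integral of [f] along the real axis, because it jumps by [-1] across that axis; the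
    term [m] contributes [h * sum_j f(jh) = r_t(x)], from the poles of the cotangent; and the
    two poles [u = L^2 - PI^2/4 +- i PI L] of [f] inside the contour contribute
    [2 PI i Res f * delta(u)], with [|Res f| = sqrt x / PI] and
    [|delta(u)| <= 1 / (e^L - 1)], hence at most [5 e^-T] together.  The integral of [f]
    along the axis is an arctangent that differs from [sqrt x] by at most [(8/3) e^-T],
    and [12 + 5 + 8/3 < 20].  For [x < e^(4 - 2T)] both [r_t(x)] and [sqrt x] are
    at most [9 e^-T]. *)

(* [Reals] exports another constant named [f], hence [Defs] comes last. *)
From Stdlib Require Import Reals Lra Lia.
From Coquelicot Require Import Coquelicot.
Require Import Defs.
Open Scope R_scope.

(** * Complex differentiability *)

(** The product [f * delta] is not holomorphic off isolated poles, since [mu] jumps across the very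
    axis on which [m] has its poles. The two parts are therefore cut differently. For [mu] the
    rectangle is halved along the axis, where [f] is regular. For [m] it is cut at the heights
    [+- PI L / 2] into three bands: the outer two contain one pole of [f] each, and the middle band,
    cut further into strips of width [h], contains one pole of the cotangent per strip. So Cauchy's
    theorem and the residue at a single simple pole, both for rectangles only, suffice; they are
    built up from the definition of the derivative.

    The shape of the contour fits the poles. A zero of the denominator of [f] has [sqrt u = L + i v]
    with [v] an odd multiple of [PI / 2], and the height [2 PI L] admits only [v = +- PI / 2]. The
    bound [L >= 2] keeps the real part [L^2 - PI^2 / 4] to the right of the edge at [1], and the
    opposite edge [4 T^2 + 1 = N_t h + 1] lies between two multiples of [h]. *)

Definition ccont (F : C -> C) (z : C) : Prop :=
  forall eps, 0 < eps -> exists d, 0 < d /\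
    forall w, Cmod (w - z) < d -> Cmod (F w - F z) < eps.

(* Carathéodory's form of differentiability: products, quotients and
   compositions reduce to algebra and continuity. *)
Definition cder (F : C -> C) (z l : C) : Prop :=
  exists phi : C -> C, ccont phi z /\ phi z = l /\
    exists r, 0 < r /\
      forall w, Cmod (w - z) < r -> F w = (F z + phi w * (w - z))%C.

Lemma Cmod_minus_self (z : C) : Cmod (z - z) = 0.
Proof. replace (z - z)%C with (RtoC 0) by ring. apply Cmod_0. Qed.

Lemma Cmod_minus_sym (z w : C) : Cmod (z - w) = Cmod (w - z).
Proof. rewrite <- Cmod_opp. f_equal. ring. Qed.

Lemma Cmod_triangle_rev (z w : C) : Cmod z - Cmod w <= Cmod (z - w).
Proof.
  replace z with ((z - w) + w)%C at 1 by ring.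
  generalize (Cmod_triangle (z - w) w). lra.
Qed.

Lemma ccont_ext_loc (F G : C -> C) z r : 0 < r ->
  (forall w, Cmod (w - z) < r -> F w = G w) -> ccont F z -> ccont G z.
Proof.
  intros Hr He HF eps Heps. destruct (HF eps Heps) as [d [Hd H]].
  exists (Rmin d r). split. { now apply Rmin_glb_lt. }
  intros w Hw. rewrite <- !He.
  - apply H. generalize (Rmin_l d r). lra.
  - now rewrite Cmod_minus_self.
  - generalize (Rmin_r d r). lra.
Qed.

Lemma ccont_const c z : ccont (fun _ => c) z.
Proof.
  intros eps Heps. exists 1. split. { lra. }
  intros w _. now rewrite Cmod_minus_self.
Qed.

Lemma ccont_id z : ccont (fun w => w) z.
Proof. intros eps Heps. exists eps. auto. Qed.

Lemma ccont_plus F G z : ccont F z -> ccont G z -> ccont (fun w => F w + G w)%C z.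
Proof.
  intros HF HG eps Heps.
  destruct (HF (eps / 2)) as [d1 [Hd1 H1]]. { lra. }
  destruct (HG (eps / 2)) as [d2 [Hd2 H2]]. { lra. }
  exists (Rmin d1 d2). split. { now apply Rmin_glb_lt. }
  intros w Hw.
  assert (A1 := H1 w). assert (A2 := H2 w).
  generalize (Rmin_l d1 d2) (Rmin_r d1 d2); intros.
  replace (F w + G w - (F z + G z))%C with ((F w - F z) + (G w - G z))%C by ring.
  generalize (Cmod_triangle (F w - F z) (G w - G z)). lra.
Qed.

Lemma ccont_mult F G z : ccont F z -> ccont G z -> ccont (fun w => F w * G w)%C z.
Proof.
  intros HF HG eps Heps.
  set (K := Cmod (F z) + Cmod (G z) + 1).
  assert (HK : 1 <= K).
  { unfold K. generalize (Cmod_ge_0 (F z)) (Cmod_ge_0 (G z)). lra. }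
  (* The cap [1] bounds the product of the two errors by a single [e], so the three error terms
     together are at most [e * K]. *)
  set (e := Rmin 1 (eps / (2 * K))).
  assert (Hq : 0 < eps / (2 * K)) by (apply Rdiv_lt_0_compat; lra).
  assert (He : 0 < e) by (apply Rmin_glb_lt; lra).
  assert (He1 : e <= 1) by apply Rmin_l.
  assert (He2 : e * K <= eps / 2).
  { replace (eps / 2) with (eps / (2 * K) * K) by (field; lra).
    apply Rmult_le_compat_r; [lra | apply Rmin_r]. }
  destruct (HF e He) as [d1 [Hd1 H1]].
  destruct (HG e He) as [d2 [Hd2 H2]].
  exists (Rmin d1 d2). split. { now apply Rmin_glb_lt. }
  intros w Hw.
  assert (A1 := H1 w). assert (A2 := H2 w).
  generalize (Rmin_l d1 d2) (Rmin_r d1 d2); intros.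
  replace (F w * G w - F z * G z)%C
    with ((F w - F z) * (G w - G z) + ((F w - F z) * G z + F z * (G w - G z)))%C by ring.
  eapply Rle_lt_trans. { apply Cmod_triangle. }
  eapply Rle_lt_trans. { apply Rplus_le_compat_l, Cmod_triangle. }
  rewrite !Cmod_mult.
  assert (B1 : Cmod (F w - F z) < e) by (apply A1; lra).
  assert (B2 : Cmod (G w - G z) < e) by (apply A2; lra).
  generalize (Cmod_ge_0 (F w - F z)) (Cmod_ge_0 (G w - G z))
    (Cmod_ge_0 (F z)) (Cmod_ge_0 (G z)); intros.
  assert (Cmod (F w - F z) * Cmod (G w - G z) <= e * 1)
    by (apply Rmult_le_compat; lra).
  assert (Cmod (F w - F z) * Cmod (G z) <= e * Cmod (G z))
    by (apply Rmult_le_compat; lra).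
  assert (Cmod (F z) * Cmod (G w - G z) <= Cmod (F z) * e)
    by (apply Rmult_le_compat; lra).
  unfold K in He2. lra.
Qed.

Lemma ccont_neq_0 F z : ccont F z -> F z <> 0 ->
  exists r, 0 < r /\ forall w, Cmod (w - z) < r -> F w <> 0.
Proof.
  intros HF Hz. destruct (HF (Cmod (F z))) as [d [Hd H]].
  { now apply Cmod_gt_0. }
  exists d. split; [exact Hd |]. intros w Hw E.
  specialize (H w Hw). rewrite E in H.
  replace (0 - F z)%C with (- F z)%C in H by ring. rewrite Cmod_opp in H. lra.
Qed.

Lemma ccont_inv F z : ccont F z -> F z <> 0 -> ccont (fun w => / F w)%C z.
Proof.
  intros HF Hz eps Heps.
  set (k := Cmod (F z)).
  assert (Hk : 0 < k) by now apply Cmod_gt_0.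
  assert (He : 0 < Rmin (k / 2) (eps * (k * k / 2))).
  { apply Rmin_glb_lt; [lra |]. apply Rmult_lt_0_compat; nra. }
  destruct (HF _ He) as [d [Hd H]].
  exists d. split; [exact Hd |]. intros w Hw. specialize (H w Hw).
  generalize (Rmin_l (k / 2) (eps * (k * k / 2))) (Rmin_r (k / 2) (eps * (k * k / 2))).
  intros M1 M2.
  assert (Hw2 : k / 2 < Cmod (F w)).
  { generalize (Cmod_triangle_rev (F z) (F w)). rewrite Cmod_minus_sym. fold k. lra. }
  assert (Hw0 : F w <> 0) by (apply Cmod_gt_0; lra).
  replace (/ F w - / F z)%C with ((F z - F w) / (F w * F z))%C by (field; auto).
  rewrite Cmod_div by now apply Cmult_neq_0.
  rewrite Cmod_mult, Cmod_minus_sym. fold k.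
  apply (Rmult_lt_reg_r (Cmod (F w) * k)). { nra. }
  unfold Rdiv. rewrite Rmult_assoc, Rinv_l, Rmult_1_r by nra.
  eapply Rlt_le_trans; [apply H |]. eapply Rle_trans; [apply M2 |].
  apply Rmult_le_compat_l; nra.
Qed.

Lemma ccont_comp F G z : ccont G z -> ccont F (G z) -> ccont (fun w => F (G w)) z.
Proof.
  intros HG HF eps Heps.
  destruct (HF eps Heps) as [e [He H1]]. destruct (HG e He) as [d [Hd H2]].
  exists d. auto.
Qed.

Lemma cder_ccont F z l : cder F z l -> ccont F z.
Proof.
  intros [phi [Hp [_ [r [Hr H]]]]].
  apply (ccont_ext_loc (fun w => F z + phi w * (w - z))%C _ _ r Hr).
  { intros w Hw. now rewrite <- H. }
  apply ccont_plus. { apply ccont_const. }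
  apply ccont_mult; [exact Hp |].
  apply ccont_plus; [apply ccont_id | apply (ccont_const (- z))].
Qed.

Lemma cder_ext F G z l : (forall w, F w = G w) -> cder F z l -> cder G z l.
Proof.
  intros E [phi [H1 [H2 [r [Hr H]]]]]. exists phi.
  split; [exact H1 |]. split; [exact H2 |]. exists r. split; [exact Hr |].
  intros w Hw. rewrite <- !E. auto.
Qed.

Lemma cder_const c z : cder (fun _ => c) z 0.
Proof.
  exists (fun _ => RtoC 0). split; [apply ccont_const |]. split; [reflexivity |].
  exists 1. split; [lra |]. intros. ring.
Qed.

Lemma cder_id z : cder (fun w => w) z 1.
Proof.
  exists (fun _ => RtoC 1). split; [apply ccont_const |]. split; [reflexivity |].
  exists 1. split; [lra |]. intros. ring.
Qed.

Lemma cder_plus F G z l k :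
  cder F z l -> cder G z k -> cder (fun w => F w + G w)%C z (l + k)%C.
Proof.
  intros [p [Hp [Ep [r [Hr H]]]]] [q [Hq [Eq [s [Hs K]]]]].
  exists (fun w => p w + q w)%C. split; [now apply ccont_plus |].
  split; [now rewrite Ep, Eq |].
  exists (Rmin r s). split; [now apply Rmin_glb_lt |].
  intros w Hw. generalize (Rmin_l r s) (Rmin_r r s); intros.
  rewrite H, K by lra. ring.
Qed.

Lemma cder_mult F G z l k :
  cder F z l -> cder G z k -> cder (fun w => F w * G w)%C z (l * G z + F z * k)%C.
Proof.
  intros HF HG. assert (CG := cder_ccont _ _ _ HG).
  destruct HF as [p [Hp [Ep [r [Hr H]]]]].
  destruct HG as [q [Hq [Eq [s [Hs K]]]]].
  exists (fun w => p w * G w + F z * q w)%C. split.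
  { apply ccont_plus; apply ccont_mult; auto. apply ccont_const. }
  split; [now rewrite Ep, Eq |].
  exists (Rmin r s). split; [now apply Rmin_glb_lt |].
  intros w Hw. generalize (Rmin_l r s) (Rmin_r r s); intros.
  rewrite (H w) by lra. rewrite (K w) by lra. ring.
Qed.

Lemma cder_inv F z l :
  cder F z l -> F z <> 0 -> cder (fun w => / F w)%C z (- (l / (F z * F z)))%C.
Proof.
  intros HF Hz. assert (CF := cder_ccont _ _ _ HF).
  destruct (ccont_neq_0 F z CF Hz) as [s [Hs K]].
  destruct HF as [p [Hp [Ep [r [Hr H]]]]].
  exists (fun w => - 1 * (p w * (/ F w * / F z)))%C. split.
  { apply ccont_mult; [apply ccont_const |].
    apply ccont_mult; [exact Hp |].
    apply ccont_mult; [now apply ccont_inv | apply ccont_const]. }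
  split. { rewrite Ep. field. exact Hz. }
  exists (Rmin r s). split; [now apply Rmin_glb_lt |].
  intros w Hw. generalize (Rmin_l r s) (Rmin_r r s); intros.
  assert (Hw0 : F w <> 0) by (apply K; lra).
  assert (E : (p w * (w - z) = F w - F z)%C) by (rewrite (H w) by lra; ring).
  replace (- 1 * (p w * (/ F w * / F z)) * (w - z))%C
    with (- 1 * (p w * (w - z)) * (/ F w * / F z))%C by ring.
  rewrite E. field. auto.
Qed.

Lemma cder_comp F G z l k :
  cder G z k -> cder F (G z) l -> cder (fun w => F (G w)) z (l * k)%C.
Proof.
  intros HG HF. assert (CG := cder_ccont _ _ _ HG).
  destruct HF as [p [Hp [Ep [r [Hr H]]]]].
  destruct HG as [q [Hq [Eq [s [Hs K]]]]].
  exists (fun w => p (G w) * q w)%C. split.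
  { apply ccont_mult; [now apply ccont_comp | exact Hq]. }
  split; [now rewrite Ep, Eq |].
  destruct (CG r Hr) as [d [Hd Hd']].
  exists (Rmin s d). split; [now apply Rmin_glb_lt |].
  intros w Hw. generalize (Rmin_l s d) (Rmin_r s d); intros.
  rewrite (H (G w)) by (apply Hd'; lra).
  replace (G w - G z)%C with (q w * (w - z))%C by (rewrite (K w) by lra; ring).
  ring.
Qed.

Lemma cder_scal c F z l : cder F z l -> cder (fun w => c * F w)%C z (c * l)%C.
Proof.
  intros HF. replace (c * l)%C with (0 * F z + c * l)%C by ring.
  apply (cder_mult (fun _ => c)); [apply cder_const | exact HF].
Qed.

Definition cdiff (F : C -> C) (z : C) : Prop := exists l, cder F z l.

Lemma cdiff_ext F G z : (forall w, F w = G w) -> cdiff F z -> cdiff G z.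
Proof. intros E [l H]. exists l. exact (cder_ext _ _ _ _ E H). Qed.

Lemma cdiff_ccont F z : cdiff F z -> ccont F z.
Proof. intros [l H]. exact (cder_ccont _ _ _ H). Qed.

Lemma cdiff_mult F G z :
  cdiff F z -> cdiff G z -> cdiff (fun w => F w * G w)%C z.
Proof. intros [l H] [k K]. eexists. exact (cder_mult _ _ _ _ _ H K). Qed.

Lemma cdiff_inv F z : cdiff F z -> F z <> 0 -> cdiff (fun w => / F w)%C z.
Proof. intros [l H] K. eexists. exact (cder_inv _ _ _ H K). Qed.

Lemma cdiff_div F G z :
  cdiff F z -> cdiff G z -> G z <> 0 -> cdiff (fun w => F w / G w)%C z.
Proof.
  intros HF HG Hz. apply (cdiff_mult F (fun w => / G w)%C); auto.
  now apply cdiff_inv.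
Qed.

(** * Exponential and square root *)

Lemma Cmod_le_abs (z : C) : Cmod z <= Rabs (Re z) + Rabs (Im z).
Proof.
  destruct z as [a b]. unfold Cmod, Re, Im; simpl fst; simpl snd.
  assert (H1 := Rabs_pos a). assert (H2 := Rabs_pos b).
  rewrite <- (sqrt_Rsqr (Rabs a + Rabs b)) by lra.
  apply sqrt_le_1_alt.
  unfold Rsqr. rewrite <- (pow2_abs a), <- (pow2_abs b). nra.
Qed.

Lemma Im_le_Cmod (z : C) : Rabs (Im z) <= Cmod z.
Proof. eapply Rle_trans; [apply Rmax_r | apply (Rmax_Cmod z)]. Qed.

Lemma Cexp_plus (z w : C) : Cexp (z + w) = (Cexp z * Cexp w)%C.
Proof.
  destruct z as [a b], w as [c d]. unfold Cexp, Cplus, Cmult, Re, Im; simpl.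
  rewrite exp_plus, cos_plus, sin_plus. f_equal; ring.
Qed.

Lemma Cmod_Cexp (z : C) : Cmod (Cexp z) = exp (Re z).
Proof.
  unfold Cmod, Cexp; simpl fst; simpl snd.
  replace ((exp (Re z) * cos (Im z)) ^ 2 + (exp (Re z) * sin (Im z)) ^ 2)
    with (Rsqr (exp (Re z))).
  { apply sqrt_Rsqr. left. apply exp_pos. }
  generalize (sin2_cos2 (Im z)). unfold Rsqr. intros E.
  transitivity (exp (Re z) * exp (Re z) *
    (sin (Im z) * sin (Im z) + cos (Im z) * cos (Im z))); [rewrite E |]; ring.
Qed.

Lemma Cexp_R (x : R) : Cexp (RtoC x) = RtoC (exp x).
Proof. unfold Cexp, RtoC; simpl. rewrite cos_0, sin_0. f_equal; ring. Qed.

(** Multiplied out, the difference quotient needs no exception at [t = 0]. The bound thus applies to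
    each component of a small complex number, even when that component vanishes. *)
Lemma first_order_bound (g : R -> R) l : is_derive g 0 l ->
  forall eps, 0 < eps -> exists d, 0 < d /\
    forall t, Rabs t < d -> Rabs (g t - g 0 - l * t) <= eps * Rabs t.
Proof.
  intros H eps Heps. apply is_derive_Reals in H.
  destruct (H eps Heps) as [d Hd]. exists d. split; [apply cond_pos |].
  intros t Ht. destruct (Req_dec t 0) as [E | E].
  { subst. rewrite Rabs_R0. replace (g 0 - g 0 - l * 0) with 0 by ring.
    rewrite Rabs_R0. lra. }
  specialize (Hd t E Ht). rewrite Rplus_0_l in Hd.
  replace (g t - g 0 - l * t) with (((g t - g 0) / t - l) * t) by (field; exact E).
  rewrite Rabs_mult. apply Rmult_le_compat_r; [apply Rabs_pos | lra].
Qed.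

Lemma Cexp_first_order (eps : R) : 0 < eps -> exists d, 0 < d /\
  forall w, Cmod w < d -> Cmod (Cexp w - 1 - w) <= eps * Cmod w.
Proof.
  intros Heps.
  (* Below, the real part of the error is at most [4 e M] and the imaginary part at most [5 e M],
     where [M] is the modulus of [w]; hence the [9]. The radius is capped by [e] too, because the
     imaginary part contains a product of two first-order terms. *)
  set (e := Rmin 1 (eps / 9)).
  assert (He : 0 < e) by (apply Rmin_glb_lt; lra).
  assert (He1 : e <= 1) by apply Rmin_l.
  assert (He2 : e <= eps / 9) by apply Rmin_r.
  assert (D1 : is_derive exp 0 1) by (auto_derive; [exact I | rewrite exp_0; ring]).
  destruct (first_order_bound exp 1 D1 e He) as [d1 [Hd1 H1]].
  assert (D2 : is_derive cos 0 0) by (auto_derive; [exact I | rewrite sin_0; ring]).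
  destruct (first_order_bound cos 0 D2 e He) as [d2 [Hd2 H2]].
  assert (D3 : is_derive sin 0 1) by (auto_derive; [exact I | rewrite cos_0; ring]).
  destruct (first_order_bound sin 1 D3 e He) as [d3 [Hd3 H3]].
  rewrite exp_0 in H1. rewrite cos_0 in H2. rewrite sin_0 in H3.
  exists (Rmin (Rmin d1 e) (Rmin d2 d3)).
  split. { apply Rmin_glb_lt; apply Rmin_glb_lt; assumption. }
  intros w Hw.
  generalize (Rmin_l (Rmin d1 e) (Rmin d2 d3)) (Rmin_r (Rmin d1 e) (Rmin d2 d3))
    (Rmin_l d1 e) (Rmin_r d1 e) (Rmin_l d2 d3) (Rmin_r d2 d3); intros.
  assert (Ha := re_le_Cmod w). assert (Hb := Im_le_Cmod w).
  destruct w as [a b]. set (M := Cmod (a, b)) in *.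
  unfold Re, Im in Ha, Hb; simpl in Ha, Hb.
  specialize (H1 a ltac:(lra)). specialize (H2 b ltac:(lra)). specialize (H3 b ltac:(lra)).
  eapply Rle_trans; [apply Cmod_le_abs |].
  unfold Cexp, Cminus, Cplus, Copp, RtoC, Re, Im; simpl.
  set (p := exp a - 1 - 1 * a) in *.
  set (q := cos b - 1 - 0 * b) in *.
  set (r := sin b - 0 - 1 * b) in *.
  replace (exp a * cos b + - (1) + - a) with (p + q * (1 + a + p))
    by (unfold p, q; ring).
  replace (exp a * sin b + - 0 + - b) with (r + (b + r) * (a + p))
    by (unfold p, r; ring).
  assert (Pa := Rabs_pos a). assert (Pb := Rabs_pos b).
  assert (PM : 0 <= M) by apply Cmod_ge_0.
  assert (Hp : Rabs p <= e * M) by nra.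
  assert (Hq : Rabs q <= e * M) by nra.
  assert (Hr : Rabs r <= e * M) by nra.
  assert (X1 : Rabs (p + q * (1 + a + p)) <= Rabs p + Rabs q * (1 + Rabs a + Rabs p)).
  { eapply Rle_trans; [apply Rabs_triang |]. apply Rplus_le_compat_l.
    rewrite Rabs_mult. apply Rmult_le_compat_l; [apply Rabs_pos |].
    eapply Rle_trans; [apply Rabs_triang |]. apply Rplus_le_compat_r.
    eapply Rle_trans; [apply Rabs_triang |]. rewrite Rabs_R1. lra. }
  assert (X2 : Rabs (r + (b + r) * (a + p)) <= Rabs r + (Rabs b + Rabs r) * (Rabs a + Rabs p)).
  { eapply Rle_trans; [apply Rabs_triang |]. apply Rplus_le_compat_l.
    rewrite Rabs_mult. apply Rmult_le_compat; try apply Rabs_pos; apply Rabs_triang. }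
  assert (M <= 1) by lra.
  assert (e * M <= 1) by nra.
  assert (Rabs q * (1 + Rabs a + Rabs p) <= e * M * 3)
    by (apply Rmult_le_compat; try apply Rabs_pos; try lra; generalize (Rabs_pos p); lra).
  assert ((Rabs b + Rabs r) * (Rabs a + Rabs p) <= 2 * M * (2 * e)).
  { apply Rmult_le_compat; try (generalize (Rabs_pos p) (Rabs_pos r); lra); nra. }
  nra.
Qed.

(** The functional equation turns the increment at [z] into [Cexp z] times the increment at [0]. The
    function [phi] is the difference quotient with its limit filled in at [z]. *)
Lemma cder_Cexp z : cder Cexp z (Cexp z).
Proof.
  set (phi := fun w => (if Ceq_dec w z then Cexp z else (Cexp w - Cexp z) / (w - z))%C).
  assert (Ez : phi z = Cexp z) by (unfold phi; destruct (Ceq_dec z z); congruence).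
  exists phi. split; [| split; [exact Ez |]].
  - intros eps Heps.
    assert (Hk : 0 < Cmod (Cexp z)) by (rewrite Cmod_Cexp; apply exp_pos).
    destruct (Cexp_first_order (eps / (2 * Cmod (Cexp z)))) as [d [Hd H]].
    { apply Rdiv_lt_0_compat; lra. }
    exists d. split; [exact Hd |]. intros w Hw. rewrite Ez. unfold phi.
    destruct (Ceq_dec w z) as [E | E]. { now rewrite Cmod_minus_self. }
    assert (E' : (w - z)%C <> 0) by now apply Cminus_eq_contra.
    replace ((Cexp w - Cexp z) / (w - z) - Cexp z)%C
      with (Cexp z * (Cexp (w - z) - 1 - (w - z)) / (w - z))%C.
    2: { replace (Cexp w) with (Cexp z * Cexp (w - z))%C.
         - field. exact E'.
         - rewrite <- Cexp_plus. f_equal. ring. }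
    rewrite Cmod_div, Cmod_mult by exact E'.
    assert (Hm : 0 < Cmod (w - z)) by now apply Cmod_gt_0.
    apply Rle_lt_trans with (eps / 2); [| lra].
    apply (Rmult_le_reg_r (Cmod (w - z))); [exact Hm |].
    unfold Rdiv at 1. rewrite Rmult_assoc, Rinv_l, Rmult_1_r by lra.
    eapply Rle_trans. { apply Rmult_le_compat_l; [lra | apply H, Hw]. }
    right. field. lra.
  - exists 1. split; [lra |]. intros w _. unfold phi.
    destruct (Ceq_dec w z) as [E | E]. { subst. ring. }
    field. now apply Cminus_eq_contra.
Qed.

Lemma Csqrt_mul_self (u : C) : (Csqrt u * Csqrt u)%C = u.
Proof.
  destruct u as [a b]. unfold Csqrt. set (M := Cmod (a, b)).
  unfold Re, Im; simpl fst; simpl snd.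
  assert (HM : 0 <= M) by apply Cmod_ge_0.
  assert (HM2 : M * M = a * a + b * b).
  { unfold M, Cmod; simpl fst; simpl snd. rewrite sqrt_sqrt; [ring | nra]. }
  assert (Ha : Rabs a <= M) by apply (re_le_Cmod (a, b)).
  assert (H1 : - M <= a <= M) by (apply Rabs_le_between; exact Ha).
  assert (S1 : sqrt ((M + a) / 2) * sqrt ((M + a) / 2) = (M + a) / 2)
    by (apply sqrt_sqrt; lra).
  assert (S2 : sqrt ((M - a) / 2) * sqrt ((M - a) / 2) = (M - a) / 2)
    by (apply sqrt_sqrt; lra).
  (* The radicals only recover the absolute value of [b]; the sign factor in [Csqrt] restores [b]
     itself. *)
  assert (S3 : sqrt ((M + a) / 2) * sqrt ((M - a) / 2) = Rabs b / 2).
  { rewrite <- sqrt_mult by lra.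
    replace ((M + a) / 2 * ((M - a) / 2)) with (Rsqr (b / 2))
      by (unfold Rsqr; nra).
    rewrite sqrt_Rsqr_abs. unfold Rdiv. rewrite Rabs_mult. f_equal.
    apply Rabs_pos_eq. lra. }
  unfold Cmult; simpl fst; simpl snd.
  destruct (Rle_dec 0 b) as [Hb | Hb].
  - rewrite Rabs_pos_eq in S3 by exact Hb. f_equal; nra.
  - rewrite Rabs_left in S3 by lra. f_equal; nra.
Qed.

Lemma Re_Csqrt_pos (u : C) : 0 < Re u -> 0 < Re (Csqrt u).
Proof.
  intros H. unfold Csqrt; simpl. apply sqrt_lt_R0.
  generalize (Cmod_ge_0 u). lra.
Qed.

Lemma Cneq_0_of_Re_pos (z : C) : 0 < Re z -> z <> 0.
Proof. intros H E. rewrite E in H. simpl in H. lra. Qed.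

Lemma Csqrt_neq_0 (u : C) : 0 < Re u -> Csqrt u <> 0.
Proof. intros H. now apply Cneq_0_of_Re_pos, Re_Csqrt_pos. Qed.

(* sqrt w - sqrt z = (w - z) / (sqrt w + sqrt z), and the denominator has real part
   at least that of sqrt z. *)
Lemma cder_Csqrt z : 0 < Re z -> cder Csqrt z (/ (2 * Csqrt z))%C.
Proof.
  intros Hz.
  assert (Hs := Re_Csqrt_pos z Hz). set (k := Re (Csqrt z)) in *.
  assert (Hw : forall w, Cmod (w - z) < Re z -> 0 < Re w).
  { intros w H. generalize (re_le_Cmod (w - z)). unfold Cminus.
    rewrite re_plus, re_opp. intros H'. apply Rabs_le_between in H'.
    unfold Cminus in H. lra. }
  assert (Hsum : forall w, 0 < Re w -> k <= Cmod (Csqrt w + Csqrt z)).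
  { intros w H. eapply Rle_trans; [| apply re_le_Cmod]. rewrite re_plus. fold k.
    generalize (Re_Csqrt_pos w H). intros. rewrite Rabs_pos_eq; lra. }
  assert (Hne : forall w, 0 < Re w -> (Csqrt w + Csqrt z)%C <> 0).
  { intros w H. apply Cmod_gt_0. generalize (Hsum w H). lra. }
  assert (E : forall w, 0 < Re w ->
    (Csqrt w - Csqrt z = / (Csqrt w + Csqrt z) * (w - z))%C).
  { intros w H. rewrite <- (Csqrt_mul_self w) at 3. rewrite <- (Csqrt_mul_self z) at 3.
    field. now apply Hne. }
  assert (Cont : ccont Csqrt z).
  { intros eps Heps. exists (Rmin (Re z) (eps * k)).
    split. { apply Rmin_glb_lt; nra. }
    intros w H. generalize (Rmin_l (Re z) (eps * k)) (Rmin_r (Re z) (eps * k)); intros.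
    assert (Pw : 0 < Re w) by (apply Hw; lra).
    rewrite E, Cmod_mult, Cmod_inv by auto.
    assert (B := Hsum w Pw).
    apply (Rmult_lt_reg_l (Cmod (Csqrt w + Csqrt z))); [lra |].
    rewrite <- Rmult_assoc, Rinv_r, Rmult_1_l by lra.
    eapply Rlt_le_trans with (eps * k); [lra |]. nra. }
  exists (fun w => / (Csqrt w + Csqrt z))%C. split; [| split].
  - apply ccont_inv.
    + apply ccont_plus; [exact Cont | apply ccont_const].
    + now apply Hne.
  - f_equal. ring.
  - exists (Re z). split; [exact Hz |]. intros w H.
    rewrite <- E by auto. ring.
Qed.

(** * Integrals over rectangle boundaries *)

Notation CInt := (@RInt C_R_CompleteNormedModule).
Notation is_CInt := (@is_RInt C_R_NormedModule).
Notation ex_CInt := (@ex_RInt C_R_NormedModule).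

Lemma CInt_correct g a b : ex_CInt g a b -> is_CInt g a b (CInt g a b).
Proof. exact (@RInt_correct C_R_CompleteNormedModule g a b). Qed.

Lemma is_CInt_unique g a b l : is_CInt g a b l -> CInt g a b = l.
Proof. exact (@is_RInt_unique C_R_CompleteNormedModule g a b l). Qed.

Lemma is_CInt_components g a b (l : C) :
  is_RInt (fun t => Re (g t)) a b (Re l) -> is_RInt (fun t => Im (g t)) a b (Im l) ->
  is_CInt g a b l.
Proof.
  intros H1 H2. rewrite (surjective_pairing l).
  exact (@is_RInt_fct_extend_pair R_NormedModule R_NormedModule g a b _ _ H1 H2).
Qed.

Lemma is_CInt_Re g a b l : is_CInt g a b l -> is_RInt (fun t => Re (g t)) a b (Re l).
Proof. exact (@is_RInt_fct_extend_fst R_NormedModule R_NormedModule g a b l). Qed.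

Lemma is_CInt_Im g a b l : is_CInt g a b l -> is_RInt (fun t => Im (g t)) a b (Im l).
Proof. exact (@is_RInt_fct_extend_snd R_NormedModule R_NormedModule g a b l). Qed.

Lemma is_CInt_plus g k a b x y : is_CInt g a b x -> is_CInt k a b y ->
  is_CInt (fun t => g t + k t)%C a b (x + y)%C.
Proof. exact (@is_RInt_plus C_R_NormedModule g k a b x y). Qed.

(** The integral takes values in [C] as a module over [R], so its scalar rule covers real factors; a
    complex factor mixes the two components. *)
Lemma is_CInt_cmult (k : C) g a b x : is_CInt g a b x ->
  is_CInt (fun t => k * g t)%C a b (k * x)%C.
Proof.
  intros H. assert (H1 := is_CInt_Re _ _ _ _ H). assert (H2 := is_CInt_Im _ _ _ _ H).
  apply is_CInt_components.
  - rewrite re_mult.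
    apply (is_RInt_ext (fun t => Re k * Re (g t) - Im k * Im (g t))).
    { intros. now rewrite re_mult. }
    apply (@is_RInt_minus R_NormedModule);
      apply (@is_RInt_scal R_NormedModule); assumption.
  - rewrite im_mult.
    apply (is_RInt_ext (fun t => Re k * Im (g t) + Im k * Re (g t))).
    { intros. now rewrite im_mult. }
    apply (@is_RInt_plus R_NormedModule);
      apply (@is_RInt_scal R_NormedModule); assumption.
Qed.

Lemma CInt_cmult (k : C) g a b : ex_CInt g a b ->
  CInt (fun t => k * g t)%C a b = (k * CInt g a b)%C.
Proof. intros H. apply is_CInt_unique, is_CInt_cmult, CInt_correct, H. Qed.

Lemma CInt_plus g k a b : ex_CInt g a b -> ex_CInt k a b ->
  CInt (fun t => g t + k t)%C a b = (CInt g a b + CInt k a b)%C.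
Proof. intros H K. apply is_CInt_unique, is_CInt_plus; now apply CInt_correct. Qed.

Lemma CInt_minus g k a b : ex_CInt g a b -> ex_CInt k a b ->
  CInt (fun t => g t - k t)%C a b = (CInt g a b - CInt k a b)%C.
Proof.
  intros H K. apply is_CInt_unique.
  exact (@is_RInt_minus C_R_NormedModule g k a b _ _ (CInt_correct _ _ _ H) (CInt_correct _ _ _ K)).
Qed.

Lemma CInt_Chasles g a b c : ex_CInt g a b -> ex_CInt g b c ->
  CInt g a c = (CInt g a b + CInt g b c)%C.
Proof. intros H K. symmetry. exact (@RInt_Chasles C_R_CompleteNormedModule g a b c H K). Qed.

Lemma CInt_ext g k a b : a <= b -> (forall t, a < t < b -> g t = k t) ->
  CInt g a b = CInt k a b.
Proof.
  intros Hab H. apply RInt_ext. intros t Ht.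
  rewrite Rmin_left, Rmax_right in Ht by exact Hab. auto.
Qed.

Lemma CInt_eq (g k : R -> C) a b : (forall t, g t = k t) -> CInt g a b = CInt k a b.
Proof. intros H. apply RInt_ext. intros t _. apply H. Qed.

Lemma Cmod_CInt_le g a b M : a <= b -> ex_CInt g a b ->
  (forall t, a <= t <= b -> Cmod (g t) <= M) -> Cmod (CInt g a b) <= (b - a) * M.
Proof.
  intros Hab He H. rewrite Cmod_norm.
  apply (@norm_RInt_le_const C_R_NormedModule g a b); auto.
  - intros t Ht. rewrite <- Cmod_norm. auto.
  - now apply CInt_correct.
Qed.

(** Isometric paths cover both kinds of edge, horizontal and vertical, each traversed at unit
    speed. *)
Lemma continuous_of_ccont (F : C -> C) (gam : R -> C) t :
  (forall s, Cmod (gam s - gam t) = Rabs (s - t)) -> ccont F (gam t) ->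
  @continuous R_UniformSpace C_UniformSpace (fun s => F (gam s)) t.
Proof.
  intros Hg HF. apply filterlim_locally. intros eps.
  destruct (HF eps (cond_pos eps)) as [d [Hd H]].
  exists (mkposreal d Hd). intros s Hs.
  apply C_NormedModule_mixin_compat1. apply H. rewrite Hg. exact Hs.
Qed.

Lemma ex_CInt_horizontal F A B c : A <= B ->
  (forall t, A <= t <= B -> ccont F (t, c)) -> ex_CInt (fun t => F (t, c)) A B.
Proof.
  intros HAB H. apply (@ex_RInt_continuous C_R_CompleteNormedModule).
  intros t Ht. rewrite Rmin_left, Rmax_right in Ht by exact HAB.
  apply (continuous_of_ccont F (fun s => (s, c))); [| now apply H].
  intros s. rewrite <- Cmod_R. f_equal.
  unfold Cminus, Cplus, Copp, RtoC; simpl. f_equal; ring.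
Qed.

Lemma ex_CInt_vertical F A c d : c <= d ->
  (forall s, c <= s <= d -> ccont F (A, s)) -> ex_CInt (fun s => F (A, s)) c d.
Proof.
  intros Hcd H. apply (@ex_RInt_continuous C_R_CompleteNormedModule).
  intros t Ht. rewrite Rmin_left, Rmax_right in Ht by exact Hcd.
  apply (continuous_of_ccont F (fun s => (A, s))); [| now apply H].
  intros s. replace ((A, s) - (A, t))%C with (Ci * RtoC (s - t))%C.
  - now rewrite Cmod_mult, Cmod_Ci, Rmult_1_l, Cmod_R.
  - unfold Ci, Cmult, Cminus, Cplus, Copp, RtoC; simpl. f_equal; ring.
Qed.

(** Agrees with [rect_integral] when [c = - a] and [d = a]; independent lower and upper edges are
    needed to cut the rectangle. *)
Definition rectI (F : C -> C) (A B c d : R) : C :=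
  (CInt (fun t => F (t, c)) A B + Ci * CInt (fun s => F (B, s)) c d
   - CInt (fun t => F (t, d)) A B - Ci * CInt (fun s => F (A, s)) c d)%C.

Definition in_rect (A B c d : R) (z : C) : Prop :=
  A <= Re z <= B /\ c <= Im z <= d.

Definition on_bd (A B c d : R) (z : C) : Prop :=
  in_rect A B c d z /\ (Im z = c \/ Im z = d \/ Re z = A \/ Re z = B).

Ltac on_bd_tac :=
  unfold on_bd, in_rect; simpl; split; [repeat split; lra | auto].

Lemma edges_ex_CInt F A B c d : A <= B -> c <= d ->
  (forall z, on_bd A B c d z -> ccont F z) ->
  (ex_CInt (fun t => F (t, c)) A B /\ ex_CInt (fun t => F (t, d)) A B) /\
  (ex_CInt (fun s => F (A, s)) c d /\ ex_CInt (fun s => F (B, s)) c d).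
Proof.
  intros HAB Hcd H. split; split.
  - apply (ex_CInt_horizontal F); [exact HAB |]; intros t Ht; apply H; on_bd_tac.
  - apply (ex_CInt_horizontal F); [exact HAB |]; intros t Ht; apply H; on_bd_tac.
  - apply (ex_CInt_vertical F); [exact Hcd |]; intros t Ht; apply H; on_bd_tac.
  - apply (ex_CInt_vertical F); [exact Hcd |]; intros t Ht; apply H; on_bd_tac.
Qed.

Lemma rectI_ext F G A B c d : A <= B -> c <= d ->
  (forall z, on_bd A B c d z -> F z = G z) -> rectI F A B c d = rectI G A B c d.
Proof.
  intros HAB Hcd H. unfold rectI.
  rewrite (CInt_ext (fun t => F (t, c)) (fun t => G (t, c))),
    (CInt_ext (fun t => F (t, d)) (fun t => G (t, d))),
    (CInt_ext (fun t => F (A, t)) (fun t => G (A, t))),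
    (CInt_ext (fun t => F (B, t)) (fun t => G (B, t)));
    auto; intros t Ht; apply H; on_bd_tac.
Qed.

Lemma rectI_plus F G A B c d : A <= B -> c <= d ->
  (forall z, on_bd A B c d z -> ccont F z) ->
  (forall z, on_bd A B c d z -> ccont G z) ->
  rectI (fun z => F z + G z)%C A B c d = (rectI F A B c d + rectI G A B c d)%C.
Proof.
  intros HAB Hcd HF HG.
  destruct (edges_ex_CInt F A B c d HAB Hcd HF) as [[F1 F2] [F3 F4]].
  destruct (edges_ex_CInt G A B c d HAB Hcd HG) as [[G1 G2] [G3 G4]].
  unfold rectI. rewrite !CInt_plus by assumption. ring.
Qed.

Lemma rectI_cmult k F A B c d : A <= B -> c <= d ->
  (forall z, on_bd A B c d z -> ccont F z) ->
  rectI (fun z => k * F z)%C A B c d = (k * rectI F A B c d)%C.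
Proof.
  intros HAB Hcd HF.
  destruct (edges_ex_CInt F A B c d HAB Hcd HF) as [[F1 F2] [F3 F4]].
  unfold rectI. rewrite !CInt_cmult by assumption. ring.
Qed.

Lemma Cmod_rectI_le F A B c d K : A <= B -> c <= d ->
  (forall z, on_bd A B c d z -> ccont F z) ->
  (forall z, on_bd A B c d z -> Cmod (F z) <= K) ->
  Cmod (rectI F A B c d) <= 2 * K * ((B - A) + (d - c)).
Proof.
  intros HAB Hcd HF HK.
  destruct (edges_ex_CInt F A B c d HAB Hcd HF) as [[F1 F2] [F3 F4]].
  assert (B1 : Cmod (CInt (fun t => F (t, c)) A B) <= (B - A) * K).
  { apply Cmod_CInt_le; auto; intros t Ht; apply HK; on_bd_tac. }
  assert (B2 : Cmod (CInt (fun t => F (t, d)) A B) <= (B - A) * K).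
  { apply Cmod_CInt_le; auto; intros t Ht; apply HK; on_bd_tac. }
  assert (B3 : Cmod (CInt (fun s => F (A, s)) c d) <= (d - c) * K).
  { apply Cmod_CInt_le; auto; intros t Ht; apply HK; on_bd_tac. }
  assert (B4 : Cmod (CInt (fun s => F (B, s)) c d) <= (d - c) * K).
  { apply Cmod_CInt_le; auto; intros t Ht; apply HK; on_bd_tac. }
  unfold rectI, Cminus.
  eapply Rle_trans; [apply Cmod_triangle |].
  eapply Rle_trans; [apply Rplus_le_compat_r, Cmod_triangle |].
  eapply Rle_trans; [apply Rplus_le_compat_r, Rplus_le_compat_r, Cmod_triangle |].
  rewrite !Cmod_opp, !Cmod_mult, Cmod_Ci. lra.
Qed.

Lemma rectI_split_vertical F A M B c d : A <= M <= B ->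
  (forall t, A <= t <= B -> ccont F (t, c)) ->
  (forall t, A <= t <= B -> ccont F (t, d)) ->
  rectI F A B c d = (rectI F A M c d + rectI F M B c d)%C.
Proof.
  intros HM H1 H2. unfold rectI.
  rewrite (CInt_Chasles (fun t => F (t, c)) A M B), (CInt_Chasles (fun t => F (t, d)) A M B);
    try (apply (ex_CInt_horizontal F); [lra |]; intros; (apply H1 || apply H2); lra).
  ring.
Qed.

Lemma rectI_split_horizontal F A B c M d : c <= M <= d ->
  (forall s, c <= s <= d -> ccont F (A, s)) ->
  (forall s, c <= s <= d -> ccont F (B, s)) ->
  rectI F A B c d = (rectI F A B c M + rectI F A B M d)%C.
Proof.
  intros HM H1 H2. unfold rectI.
  rewrite (CInt_Chasles (fun t => F (A, t)) c M d), (CInt_Chasles (fun t => F (B, t)) c M d);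
    try (apply (ex_CInt_vertical F); [lra |]; intros; (apply H1 || apply H2); lra).
  ring.
Qed.

Lemma is_RInt_affine (p q a b : R) :
  is_RInt (fun t => p + t * q) a b ((b - a) * p + (b * b - a * a) / 2 * q).
Proof.
  replace ((b - a) * p + (b * b - a * a) / 2 * q)
    with (minus (b * p + b * b / 2 * q) (a * p + a * a / 2 * q)).
  2: { unfold minus, plus, opp; simpl. field. }
  apply (@is_RInt_derive R_CompleteNormedModule (fun t => t * p + t * t / 2 * q)).
  - intros t _. auto_derive; [exact I | field].
  - intros t _. apply (ex_derive_continuous (fun t => p + t * q)). auto_derive. exact I.
Qed.

Lemma CInt_affine (p q : C) (a b : R) :
  CInt (fun t => p + RtoC t * q)%C a b
  = (RtoC (b - a) * p + RtoC ((b * b - a * a) / 2) * q)%C.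
Proof.
  apply is_CInt_unique, is_CInt_components.
  - apply (is_RInt_ext (fun t => Re p + t * Re q)).
    { intros. now rewrite re_plus, re_scal_l. }
    rewrite re_plus, !re_scal_l. apply is_RInt_affine.
  - apply (is_RInt_ext (fun t => Im p + t * Im q)).
    { intros. now rewrite im_plus, im_scal_l. }
    rewrite im_plus, !im_scal_l. apply is_RInt_affine.
Qed.

(** Goursat's argument subtracts the first-order part of [F] at a point. On every edge that part is
    affine in the real parameter, so the integral is a polynomial identity in the corners. *)
Lemma rectI_affine (k l p : C) A B c d :
  rectI (fun z => k + l * (z - p))%C A B c d = 0.
Proof.
  assert (Hh : forall y, CInt (fun t => k + l * ((t, y) - p))%C A B
    = CInt (fun t => (k + l * ((0, y) - p)) + RtoC t * l)%C A B).
  { intros y. apply CInt_eq. intros t.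
    replace ((t, y) : C) with (RtoC t + (0, y))%C; [ring |].
    unfold RtoC, Cplus; simpl; f_equal; ring. }
  assert (Hv : forall y, CInt (fun s => k + l * ((y, s) - p))%C c d
    = CInt (fun s => (k + l * (RtoC y - p)) + RtoC s * (Ci * l))%C c d).
  { intros y. apply CInt_eq. intros s.
    replace ((y, s) : C) with (RtoC y + RtoC s * Ci)%C; [ring |].
    unfold RtoC, Ci, Cmult, Cplus; simpl; f_equal; ring. }
  unfold rectI. rewrite !Hh, !Hv, !CInt_affine.
  destruct k as [k1 k2], l as [l1 l2], p as [p1 p2].
  unfold Ci, RtoC, Cminus, Copp, Cmult, Cplus; simpl. f_equal; field.
Qed.

(** * Cauchy's theorem on rectangles, by bisection *)

Lemma nested_intervals (a b : nat -> R) :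
  (forall n, a n <= a (S n)) -> (forall n, b (S n) <= b n) -> (forall n, a n <= b n) ->
  exists p, forall n, a n <= p <= b n.
Proof.
  intros Ha Hb Hab.
  assert (Ma : forall n m, (n <= m)%nat -> a n <= a m).
  { intros n m H. induction H; [lra |]. generalize (Ha m). lra. }
  assert (Mb : forall n m, (n <= m)%nat -> b m <= b n).
  { intros n m H. induction H; [lra |]. generalize (Hb m). lra. }
  assert (Mab : forall n m, a n <= b m).
  { intros n m. destruct (Nat.le_ge_cases n m) as [H | H].
    - generalize (Ma _ _ H) (Hab m). lra.
    - generalize (Mb _ _ H) (Hab n). lra. }
  destruct (completeness (fun x => exists n, x = a n)) as [p [Hp1 Hp2]].
  - exists (b 0%nat). intros x [n ->]. apply Mab.
  - exists (a 0%nat), 0%nat. reflexivity.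
  - exists p. intros n. split.
    + apply Hp1. now exists n.
    + apply Hp2. intros x [k ->]. apply Mab.
Qed.

Record rectangle := Rect { rA : R; rB : R; rc : R; rd : R }.

Definition rect_wf (q : rectangle) : Prop := rA q <= rB q /\ rc q <= rd q.

Definition rectJ (F : C -> C) (q : rectangle) : C := rectI F (rA q) (rB q) (rc q) (rd q).

Definition half_of (q q' : rectangle) : Prop :=
  (rA q <= rA q' /\ rB q' <= rB q /\ rB q' - rA q' = (rB q - rA q) / 2) /\
  (rc q <= rc q' /\ rd q' <= rd q /\ rd q' - rc q' = (rd q - rc q) / 2).

(** Selects a quadrant that carries at least a quarter of the integral. The last one needs no test:
    if the other three fall short, the triangle inequality forces it to qualify. *)
Definition bisect (F : C -> C) (q : rectangle) : rectangle :=
  let x := (rA q + rB q) / 2 in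
  let y := (rc q + rd q) / 2 in
  let q1 := Rect (rA q) x (rc q) y in
  let q2 := Rect x (rB q) (rc q) y in
  let q3 := Rect (rA q) x y (rd q) in
  let q4 := Rect x (rB q) y (rd q) in
  let k := Cmod (rectJ F q) / 4 in
  if Rle_dec k (Cmod (rectJ F q1)) then q1
  else if Rle_dec k (Cmod (rectJ F q2)) then q2
  else if Rle_dec k (Cmod (rectJ F q3)) then q3 else q4.

Lemma bisect_half F q : rect_wf q -> half_of q (bisect F q).
Proof.
  intros [H1 H2]. unfold bisect.
  repeat match goal with |- context [if ?x then _ else _] => destruct x end;
    unfold half_of; simpl; lra.
Qed.

Lemma bisect_ge F q : rect_wf q ->
  (forall z, in_rect (rA q) (rB q) (rc q) (rd q) z -> ccont F z) ->
  Cmod (rectJ F q) / 4 <= Cmod (rectJ F (bisect F q)).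
Proof.
  intros [H1 H2] HF. unfold bisect.
  set (x := (rA q + rB q) / 2). set (y := (rc q + rd q) / 2).
  set (q1 := Rect (rA q) x (rc q) y). set (q2 := Rect x (rB q) (rc q) y).
  set (q3 := Rect (rA q) x y (rd q)). set (q4 := Rect x (rB q) y (rd q)).
  assert (E : rectJ F q = (rectJ F q1 + rectJ F q2 + (rectJ F q3 + rectJ F q4))%C).
  { unfold rectJ, q1, q2, q3, q4; simpl.
    rewrite (rectI_split_horizontal F (rA q) (rB q) (rc q) y (rd q)).
    - rewrite (rectI_split_vertical F (rA q) x (rB q) (rc q) y).
      + rewrite (rectI_split_vertical F (rA q) x (rB q) y (rd q)).
        * ring.
        * unfold x; lra.
        * intros; apply HF; unfold in_rect, y; simpl; lra.
        * intros; apply HF; unfold in_rect, y; simpl; lra.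
      + unfold x; lra.
      + intros; apply HF; unfold in_rect, y; simpl; lra.
      + intros; apply HF; unfold in_rect, y; simpl; lra.
    - unfold y; lra.
    - intros; apply HF; unfold in_rect, y; simpl; lra.
    - intros; apply HF; unfold in_rect, y; simpl; lra. }
  destruct (Rle_dec _ (Cmod (rectJ F q1))) as [K1 | K1]; [exact K1 |].
  destruct (Rle_dec _ (Cmod (rectJ F q2))) as [K2 | K2]; [exact K2 |].
  destruct (Rle_dec _ (Cmod (rectJ F q3))) as [K3 | K3]; [exact K3 |].
  assert (T := Cmod_triangle (rectJ F q1 + rectJ F q2) (rectJ F q3 + rectJ F q4)).
  rewrite <- E in T.
  generalize (Cmod_triangle (rectJ F q1) (rectJ F q2))
    (Cmod_triangle (rectJ F q3) (rectJ F q4)). lra.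
Qed.

(** Let [eta] be the modulus of the integral. After [n] bisections at least [eta / 4 ^ n] survives.
    Near the common point [p], however, [F] is its tangent up to [e * Cmod (z - p)]; the tangent
    integrates to zero, and diameter times perimeter leaves at most [2 e (D / 2 ^ n) ^ 2]. Both
    sides scale by [4 ^ n], and a small [e] gives a contradiction. *)
Theorem Cauchy_Goursat F A B c d : A <= B -> c <= d ->
  (forall z, in_rect A B c d z -> cdiff F z) -> rectI F A B c d = 0.
Proof.
  intros HAB Hcd HF. apply Cmod_eq_0.
  destruct (Rle_lt_or_eq_dec _ _ (Cmod_ge_0 (rectI F A B c d))) as [Hpos | E]; [| auto].
  exfalso. set (eta := Cmod (rectI F A B c d)) in *.
  set (q := fun n => Nat.iter n (bisect F) (Rect A B c d)).
  assert (Inv : forall n, rect_wf (q n) /\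
    (A <= rA (q n) /\ rB (q n) <= B /\ c <= rc (q n) /\ rd (q n) <= d)).
  { induction n as [| n [W IH]].
    - unfold rect_wf; simpl. lra.
    - destruct (bisect_half F (q n) W) as [P1 P2]. destruct W as [W1 W2].
      unfold rect_wf. change (q (S n)) with (bisect F (q n)). lra. }
  assert (Half : forall n, half_of (q n) (q (S n))).
  { intros n. apply bisect_half, Inv. }
  assert (Cont : forall n z, in_rect (rA (q n)) (rB (q n)) (rc (q n)) (rd (q n)) z ->
    in_rect A B c d z).
  { intros n z [Z1 Z2]. destruct (Inv n) as [_ I]. unfold in_rect. lra. }
  assert (Big : forall n, eta / 4 ^ n <= Cmod (rectJ F (q n))).
  { induction n as [| n IH].
    - simpl. unfold rectJ; simpl. fold eta. lra.
    - apply Rle_trans with (Cmod (rectJ F (q n)) / 4).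
      + assert (4 ^ n <> 0) by (apply pow_nonzero; lra).
        replace (eta / 4 ^ S n) with (eta / 4 ^ n / 4) by (simpl; field; assumption).
        lra.
      + apply bisect_ge; [apply Inv |]. intros z Hz.
        apply cdiff_ccont, HF. eapply Cont. exact Hz. }
  assert (Len : forall n, rB (q n) - rA (q n) = (B - A) / 2 ^ n /\
                          rd (q n) - rc (q n) = (d - c) / 2 ^ n).
  { induction n as [| n [I1 I2]].
    - simpl. split; field.
    - destruct (Half n) as [[_ [_ L1]] [_ [_ L2]]].
      assert (2 ^ n <> 0) by (apply pow_nonzero; lra).
      rewrite L1, L2, I1, I2. simpl. split; field; assumption. }
  destruct (nested_intervals (fun n => rA (q n)) (fun n => rB (q n))) as [px Hpx].
  { intros n. apply (Half n). } { intros n. apply (Half n). }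
  { intros n. apply (proj1 (Inv n)). }
  destruct (nested_intervals (fun n => rc (q n)) (fun n => rd (q n))) as [py Hpy].
  { intros n. apply (Half n). } { intros n. apply (Half n). }
  { intros n. apply (proj1 (Inv n)). }
  set (p := (px, py) : C).
  assert (Pin : in_rect A B c d p).
  { apply (Cont 0%nat). split; [apply Hpx | apply Hpy]. }
  destruct (HF p Pin) as [l [phi [Hphi [El [r [Hr Hexp]]]]]].
  set (D := (B - A) + (d - c)).
  assert (HD : 0 <= D) by (unfold D; lra).
  (* Makes [2 e D^2 < eta]. The summand [1] keeps the divisor positive for a rectangle reduced to a
     point. *)
  set (e := eta / (4 * (D * D) + 1)).
  assert (HD2 : 0 < 4 * (D * D) + 1) by nra.
  assert (He : 0 < e) by (apply Rdiv_lt_0_compat; assumption).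
  assert (Ee : e * (4 * (D * D) + 1) = eta) by (unfold e; field; lra).
  destruct (Hphi e He) as [s [Hs Hs']].
  assert (Hrs : 0 < Rmin r s) by now apply Rmin_glb_lt.
  assert (Hn : exists n, D / 2 ^ n < Rmin r s).
  { destruct (pow_lt_1_zero (/ 2)) with (y := Rmin r s / (D + 1)) as [n Hn].
    - rewrite Rabs_pos_eq; lra.
    - apply Rdiv_lt_0_compat; lra.
    - exists n. specialize (Hn n (le_n n)).
      assert (P := pow_lt (/ 2) n ltac:(lra)).
      rewrite Rabs_pos_eq in Hn by lra.
      unfold Rdiv. rewrite <- pow_inv.
      apply Rle_lt_trans with ((D + 1) * (/ 2) ^ n); [nra |].
      apply (Rmult_lt_compat_l (D + 1)) in Hn; [| lra].
      replace ((D + 1) * (Rmin r s / (D + 1))) with (Rmin r s) in Hn by (field; lra).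
      exact Hn. }
  destruct Hn as [n Hn].
  assert (P2 : 0 < 2 ^ n) by (apply pow_lt; lra).
  generalize (Rmin_l r s) (Rmin_r r s); intros M1 M2.
  destruct (Len n) as [L1 L2]. destruct (Inv n) as [[W1 W2] _].
  specialize (Hpx n). specialize (Hpy n). simpl in Hpx, Hpy.
  assert (Near : forall z, in_rect (rA (q n)) (rB (q n)) (rc (q n)) (rd (q n)) z ->
    Cmod (z - p) <= D / 2 ^ n).
  { intros z [Z1 Z2]. eapply Rle_trans; [apply Cmod_le_abs |].
    unfold Cminus. rewrite re_plus, im_plus, re_opp, im_opp.
    replace (Re p) with px by reflexivity. replace (Im p) with py by reflexivity.
    replace (D / 2 ^ n) with ((B - A) / 2 ^ n + (d - c) / 2 ^ n)
      by (unfold D; field; lra).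
    rewrite <- L1, <- L2.
    apply Rplus_le_compat; apply Rabs_le; lra. }
  set (G := fun z => (F z + - 1 * (F p + l * (z - p)))%C).
  assert (Caff : forall z, ccont (fun z => F p + l * (z - p))%C z).
  { intros z. apply ccont_plus; [apply ccont_const |]. apply ccont_mult; [apply ccont_const |].
    apply ccont_plus; [apply ccont_id | apply (ccont_const (- p))]. }
  assert (CF : forall z, on_bd (rA (q n)) (rB (q n)) (rc (q n)) (rd (q n)) z -> ccont F z).
  { intros z [Hz _]. apply cdiff_ccont, HF. eapply Cont. exact Hz. }
  assert (EG : rectJ F (q n) = rectI G (rA (q n)) (rB (q n)) (rc (q n)) (rd (q n))).
  { unfold G. rewrite rectI_plus; auto.
    - rewrite rectI_cmult, rectI_affine; auto. unfold rectJ. ring.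
    - intros z _. apply ccont_mult; [apply ccont_const | apply Caff]. }
  assert (Bd : Cmod (rectJ F (q n)) <= 2 * (e * (D / 2 ^ n)) * (D / 2 ^ n)).
  { rewrite EG.
    replace (D / 2 ^ n) with ((rB (q n) - rA (q n)) + (rd (q n) - rc (q n))) at 2
      by (rewrite L1, L2; unfold D; field; lra).
    apply Cmod_rectI_le; auto.
    - intros z Hz. apply ccont_plus; [now apply CF |].
      apply ccont_mult; [apply ccont_const | apply Caff].
    - intros z [Hz _]. assert (N := Near z Hz). unfold G.
      rewrite (Hexp z) by lra. rewrite <- El.
      replace (F p + phi z * (z - p) + -1 * (F p + phi p * (z - p)))%C
        with ((phi z - phi p) * (z - p))%C by ring.
      rewrite Cmod_mult. apply Rmult_le_compat; try apply Cmod_ge_0; [| exact N].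
      left. apply Hs'. lra. }
  specialize (Big n).
  assert (E4 : 4 ^ n = 2 ^ n * 2 ^ n) by (rewrite <- Rpow_mult_distr; f_equal; ring).
  assert (X : eta <= 2 * e * (D * D)).
  { apply (Rmult_le_reg_r (/ (2 ^ n * 2 ^ n))).
    - apply Rinv_0_lt_compat. nra.
    - eapply Rle_trans; [| eapply Rle_trans; [exact Bd |]].
      + rewrite <- E4. exact Big.
      + right. field. lra. }
  nra.
Qed.

(** * The residue at a simple pole *)

Lemma sum_sqr_neq_0 (a r : R) : 0 < r -> a * a + r * r <> 0.
Proof. intros Hr. generalize (Rle_0_sqr a). unfold Rsqr. nra. Qed.

Lemma is_RInt_zero (a b : R) : is_RInt (fun _ : R => 0) a b 0.
Proof.
  assert (H := @is_RInt_const R_NormedModule a b 0).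
  now rewrite (@scal_zero_r R_Ring R_ModuleSpace) in H.
Qed.

Lemma is_RInt_atan (p r : R) : 0 < r ->
  is_RInt (fun t => 2 * r / ((t - p) * (t - p) + r * r)) (p - r) (p + r) PI.
Proof.
  intros Hr.
  replace PI with (minus (2 * atan ((p + r - p) / r)) (2 * atan ((p - r - p) / r))).
  2: { replace ((p + r - p) / r) with 1 by (field; lra).
       replace ((p - r - p) / r) with (- (1)) by (field; lra).
       rewrite atan_opp, atan_1. unfold minus, plus, opp; simpl. field. }
  assert (Hne : forall t, (t - p) * (t - p) + r * r <> 0) by (intros t; now apply sum_sqr_neq_0).
  apply (@is_RInt_derive R_CompleteNormedModule (fun t => 2 * atan ((t - p) / r))).
  - intros t _. auto_derive; [exact I |]. field. split; [| lra].
    replace (r ^ 2 + (t - p) ^ 2) with ((t - p) * (t - p) + r * r) by ring. apply Hne.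
  - intros t _. apply (ex_derive_continuous (fun t => 2 * r / ((t - p) * (t - p) + r * r))).
    auto_derive. apply Hne.
Qed.

(** Opposite edges are integrated together: in the difference of their integrands one component
    cancels and the other is [2 r / (t^2 + r^2)], with [t] measured from the centre. Each pair thus
    contributes [i PI], without any complex logarithm. *)
Lemma rectI_inv_square (p : C) r : 0 < r ->
  rectI (fun z => / (z - p))%C (Re p - r) (Re p + r) (Im p - r) (Im p + r)
  = (2 * PI * Ci)%C.
Proof.
  intros Hr. destruct p as [px py]. unfold Re, Im; simpl.
  set (g := fun z => (/ (z - (px, py)))%C).
  assert (Hne : forall z, Rabs (Re z - px) = r \/ Rabs (Im z - py) = r ->
    (z - (px, py))%C <> 0).
  { intros [a b] H E. unfold Cminus, Cplus, Copp, RtoC in E; simpl in E.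
    unfold Re, Im in H; simpl in H. injection E as E1 E2.
    replace (a - px) with 0 in H by lra. replace (b - py) with 0 in H by lra.
    rewrite Rabs_R0 in H. lra. }
  assert (Hc : forall z, Rabs (Re z - px) = r \/ Rabs (Im z - py) = r -> ccont g z).
  { intros z H. apply ccont_inv; [| now apply Hne].
    apply ccont_plus; [apply ccont_id | apply (ccont_const (- (px, py)))]. }
  destruct (edges_ex_CInt g (px - r) (px + r) (py - r) (py + r)) as [[E1 E2] [E3 E4]];
    try lra.
  { intros z [_ H]. apply Hc.
    destruct H as [H | [H | [H | H]]]; rewrite H; [right | right | left | left];
      unfold Rabs; destruct (Rcase_abs _); lra. }
  unfold rectI. fold g.
  transitivity ((CInt (fun t => g (t, (py - r)%R)) (px - r) (px + r)
                 - CInt (fun t => g (t, (py + r)%R)) (px - r) (px + r))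
    + Ci * (CInt (fun s => g ((px + r)%R, s)) (py - r) (py + r)
            - CInt (fun s => g ((px - r)%R, s)) (py - r) (py + r)))%C.
  { unfold g. ring. }
  rewrite <- !CInt_minus by assumption.
  assert (Hne2 : forall t u, (t - u) * (t - u) + r * r <> 0) by (intros; now apply sum_sqr_neq_0).
  assert (X1 : CInt (fun t => g (t, (py - r)%R) - g (t, (py + r)%R))%C (px - r) (px + r)
    = (0, PI)).
  { apply is_CInt_unique, is_CInt_components.
    - apply (is_RInt_ext (fun t => 0)).
      + intros t _. assert (N := Hne2 t px). unfold g, Cinv, Cminus, Cplus, Copp, Re; simpl.
        field. repeat split; intros Z; apply N; rewrite <- Z; ring.
      + apply is_RInt_zero.
    - apply (is_RInt_ext (fun t => 2 * r / ((t - px) * (t - px) + r * r))).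
      + intros t _. assert (N := Hne2 t px). unfold g, Cinv, Cminus, Cplus, Copp, Im; simpl.
        field. repeat split; intros Z; apply N; rewrite <- Z; ring.
      + apply is_RInt_atan, Hr. }
  assert (X2 : CInt (fun s => g ((px + r)%R, s) - g ((px - r)%R, s))%C (py - r) (py + r)
    = (PI, 0)).
  { apply is_CInt_unique, is_CInt_components.
    - apply (is_RInt_ext (fun t => 2 * r / ((t - py) * (t - py) + r * r))).
      + intros t _. assert (N := Hne2 t py). unfold g, Cinv, Cminus, Cplus, Copp, Re; simpl.
        field. repeat split; intros Z; apply N; rewrite <- Z; ring.
      + apply is_RInt_atan, Hr.
    - apply (is_RInt_ext (fun t => 0)).
      + intros t _. assert (N := Hne2 t py). unfold g, Cinv, Cminus, Cplus, Copp, Im; simpl.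
        field. repeat split; intros Z; apply N; rewrite <- Z; ring.
      + apply is_RInt_zero. }
  rewrite X1, X2. unfold Ci, RtoC, Cmult, Cplus; simpl. f_equal; ring.
Qed.

(** Four rectangles free of [p] are cut off, leaving a square of half-side [r] around it. There [F]
    differs from [k / (z - p)] by at most [eps / (8 r)], and the perimeter is [8 r]. *)
Lemma residue_limit F A B c d (p k : C) :
  A < Re p < B -> c < Im p < d ->
  (forall z, in_rect A B c d z -> z <> p -> cdiff F z) ->
  (forall eps, 0 < eps -> exists e, 0 < e /\
     forall z, z <> p -> Cmod (z - p) < e -> Cmod ((z - p) * F z - k) < eps) ->
  rectI F A B c d = (2 * PI * Ci * k)%C.
Proof.
  intros HA Hc HF Hlim. apply Ceq_minus, Cmod_eq_0.
  apply Rle_antisym; [| apply Cmod_ge_0].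
  apply le_epsilon. intros eps Heps. rewrite Rplus_0_l.
  destruct (Hlim (eps / 8)) as [e [He Hk]]; [lra |].
  set (x := Re p) in *. set (y := Im p) in *.
  (* A point of the square is within [2 r] of [p], hence the [e / 3]; halving the distance to the
     edges keeps the square strictly inside. *)
  set (r := Rmin (e / 3) (Rmin (Rmin (x - A) (B - x)) (Rmin (y - c) (d - y)) / 2)).
  assert (Hr : 0 < r /\ 3 * r <= e /\ (A < x - r /\ x + r < B) /\ (c < y - r /\ y + r < d)).
  { unfold r.
    generalize (Rmin_l (e / 3) (Rmin (Rmin (x - A) (B - x)) (Rmin (y - c) (d - y)) / 2))
      (Rmin_r (e / 3) (Rmin (Rmin (x - A) (B - x)) (Rmin (y - c) (d - y)) / 2))
      (Rmin_l (Rmin (x - A) (B - x)) (Rmin (y - c) (d - y)))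
      (Rmin_r (Rmin (x - A) (B - x)) (Rmin (y - c) (d - y)))
      (Rmin_l (x - A) (B - x)) (Rmin_r (x - A) (B - x))
      (Rmin_l (y - c) (d - y)) (Rmin_r (y - c) (d - y)); intros.
    assert (0 < Rmin (Rmin (x - A) (B - x)) (Rmin (y - c) (d - y)))
      by (repeat apply Rmin_glb_lt; lra).
    split; [apply Rmin_glb_lt; lra | lra]. }
  destruct Hr as [Hr [Hre [[R1 R2] [R3 R4]]]].
  assert (Np : forall z, Re z <> x \/ Im z <> y -> z <> p).
  { intros z [H | H] E; apply H; rewrite E; reflexivity. }
  assert (Dif : forall z, in_rect A B c d z -> Re z <> x \/ Im z <> y -> cdiff F z).
  { intros z Hz H. apply HF; auto. }
  assert (Cnt : forall z, in_rect A B c d z -> Re z <> x \/ Im z <> y -> ccont F z).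
  { intros z Hz H. apply cdiff_ccont, Dif; auto. }
  assert (E : rectI F A B c d = rectI F (x - r) (x + r) (y - r) (y + r)).
  { rewrite (rectI_split_vertical F A (x - r) B c d); try lra;
      try (intros; apply Cnt; unfold in_rect; simpl; lra).
    rewrite (rectI_split_vertical F (x - r) (x + r) B c d); try lra;
      try (intros; apply Cnt; unfold in_rect; simpl; lra).
    rewrite (rectI_split_horizontal F (x - r) (x + r) c (y - r) d); try lra;
      try (intros; apply Cnt; unfold in_rect; simpl; lra).
    rewrite (rectI_split_horizontal F (x - r) (x + r) (y - r) (y + r) d); try lra;
      try (intros; apply Cnt; unfold in_rect; simpl; lra).
    rewrite (Cauchy_Goursat F A (x - r) c d), (Cauchy_Goursat F (x + r) B c d),
      (Cauchy_Goursat F (x - r) (x + r) c (y - r)),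
      (Cauchy_Goursat F (x - r) (x + r) (y + r) d); try lra;
      try (intros z [Z1 Z2]; apply Dif; unfold in_rect; lra).
    ring. }
  rewrite E, <- (rectI_inv_square p r Hr). fold x y.
  assert (Off : forall z, on_bd (x - r) (x + r) (y - r) (y + r) z ->
    r <= Cmod (z - p) /\ Cmod (z - p) < e /\ z <> p /\ ccont F z).
  { intros z [[Z1 Z2] Z3].
    assert (Rr := re_le_Cmod (z - p)). assert (Ri := Im_le_Cmod (z - p)).
    assert (Ru := Cmod_le_abs (z - p)).
    unfold Cminus in Rr at 1, Ri at 1, Ru at 2 3.
    rewrite re_plus, re_opp in Rr, Ru. rewrite im_plus, im_opp in Ri, Ru.
    fold x in Rr, Ru. fold y in Ri, Ru.
    assert (Rabs (Re z + - x) <= r) by (apply Rabs_le; lra).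
    assert (Rabs (Im z + - y) <= r) by (apply Rabs_le; lra).
    assert (Off : Re z <> x \/ Im z <> y).
    { destruct Z3 as [H1 | [H1 | [H1 | H1]]]; [right | right | left | left]; lra. }
    repeat split.
    - assert (P : r <= Rabs (Re z + - x) \/ r <= Rabs (Im z + - y)).
      { destruct Z3 as [H1 | [H1 | [H1 | H1]]]; [right | right | left | left];
          rewrite H1; unfold Rabs; destruct (Rcase_abs _); lra. }
      destruct P; lra.
    - lra.
    - now apply Np.
    - apply Cnt; [unfold in_rect; lra | exact Off]. }
  assert (Ci' : forall z, on_bd (x - r) (x + r) (y - r) (y + r) z ->
    ccont (fun z => / (z - p))%C z).
  { intros z Hz. destruct (Off z Hz) as [_ [_ [N _]]].
    apply ccont_inv; [| now apply Cminus_eq_contra].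
    apply ccont_plus; [apply ccont_id | apply (ccont_const (- p))]. }
  replace (rectI F (x - r) (x + r) (y - r) (y + r)
    - rectI (fun z => / (z - p)) (x - r) (x + r) (y - r) (y + r) * k)%C
    with (rectI (fun z => F z + - k * / (z - p))%C (x - r) (x + r) (y - r) (y + r)).
  2: { rewrite rectI_plus; try lra.
       - rewrite rectI_cmult; [ring | lra | lra | exact Ci'].
       - intros z Hz. apply (Off z Hz).
       - intros z Hz. apply ccont_mult; [apply ccont_const | now apply Ci']. }
  eapply Rle_trans.
  - apply (Cmod_rectI_le _ _ _ _ _ (eps / 8 / r)); try lra.
    + intros z Hz. apply ccont_plus; [apply (Off z Hz) |].
      apply ccont_mult; [apply ccont_const | now apply Ci'].
    + intros z Hz. destruct (Off z Hz) as [O1 [O2 [O3 _]]].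
      assert (N := Cminus_eq_contra _ _ O3).
      replace (F z + - k * / (z - p))%C with (((z - p) * F z - k) / (z - p))%C
        by (field; exact N).
      rewrite Cmod_div by exact N.
      apply Rmult_le_compat; [apply Cmod_ge_0 | left; apply Rinv_0_lt_compat; lra | |].
      * left. now apply Hk.
      * apply Rinv_le_contravar; lra.
  - right. field. lra.
Qed.

(** Carathéodory's form gives [S z = phi z * (z - p)] near [p], so [(z - p) * F z] is [G z / phi z],
    which is continuous at [p]. *)
Theorem residue_simple_pole F G S A B c d (p l : C) :
  A < Re p < B -> c < Im p < d ->
  (forall z, in_rect A B c d z -> z <> p -> cdiff F z) ->
  (forall z, F z = G z / S z)%C ->
  ccont G p -> cder S p l -> S p = 0 -> l <> 0 ->
  rectI F A B c d = (2 * PI * Ci * (G p / l))%C.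
Proof.
  intros HA Hc HF HE HG [phi [Hphi [El [r [Hr HS]]]]] Sp Hl.
  apply (residue_limit F A B c d p); auto.
  intros eps Heps.
  assert (Q : ccont (fun z => G z * / phi z)%C p).
  { apply ccont_mult; [exact HG |]. apply ccont_inv; [exact Hphi | now rewrite El]. }
  destruct (Q eps Heps) as [e [He H]].
  destruct (ccont_neq_0 phi p Hphi) as [s [Hs Hs']]; [now rewrite El |].
  exists (Rmin e (Rmin r s)).
  split. { apply Rmin_glb_lt; [exact He | now apply Rmin_glb_lt]. }
  intros z Hz Hd.
  generalize (Rmin_l e (Rmin r s)) (Rmin_r e (Rmin r s)) (Rmin_l r s) (Rmin_r r s); intros.
  assert (N := Cminus_eq_contra _ _ Hz).
  assert (Nphi : phi z <> 0) by (apply Hs'; lra).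
  rewrite HE, (HS z), Sp by lra.
  replace ((z - p) * (G z / (0 + phi z * (z - p))) - G p / l)%C
    with (G z * / phi z - G p * / phi p)%C.
  - apply H. lra.
  - rewrite El. field. auto.
Qed.

(** * The poles of [f] and of [m] *)

Definition Lx (Nt : nat) (x : R) : R := Tt Nt + / 2 * ln x.

Definition den (Nt : nat) (x : R) (u : C) : C :=
  (Cexp (2 * (Csqrt u - RtoC (Tt Nt))) + RtoC x)%C.

Lemma cder_shifted_sqrt Nt u : 0 < Re u ->
  cder (fun u => Csqrt u - RtoC (Tt Nt))%C u (/ (2 * Csqrt u))%C.
Proof.
  intros Hu. replace (/ (2 * Csqrt u))%C with (/ (2 * Csqrt u) + 0)%C by ring.
  apply (cder_plus Csqrt (fun _ => - RtoC (Tt Nt))%C);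
    [now apply cder_Csqrt | apply cder_const].
Qed.

Lemma cder_den Nt x u : 0 < Re u ->
  cder (den Nt x) u (Cexp (2 * (Csqrt u - RtoC (Tt Nt))) / Csqrt u)%C.
Proof.
  intros Hu. assert (N := Csqrt_neq_0 u Hu).
  replace (Cexp (2 * (Csqrt u - RtoC (Tt Nt))) / Csqrt u)%C
    with (Cexp (2 * (Csqrt u - RtoC (Tt Nt))) * (2 * / (2 * Csqrt u)) + 0)%C.
  2: { field. exact N. }
  apply (cder_plus _ (fun _ => RtoC x)); [| apply cder_const].
  apply (cder_comp Cexp (fun u => 2 * (Csqrt u - RtoC (Tt Nt)))%C); [| apply cder_Cexp].
  now apply cder_scal, cder_shifted_sqrt.
Qed.

Definition fnum (Nt : nat) (x : R) (u : C) : C :=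
  (RtoC (x / PI) * / Csqrt u * Cexp (Csqrt u - RtoC (Tt Nt)))%C.

Lemma f_fnum_den Nt x u : f Nt u x = (fnum Nt x u / den Nt x u)%C.
Proof. unfold f, fnum, den, Cdiv. ring. Qed.

Lemma cdiff_fnum Nt x u : 0 < Re u -> cdiff (fnum Nt x) u.
Proof.
  intros Hu. apply cdiff_mult.
  - apply cdiff_mult.
    + eexists. apply cder_const.
    + apply cdiff_inv; [| now apply Csqrt_neq_0]. eexists. now apply cder_Csqrt.
  - eexists. apply (cder_comp Cexp (fun u => Csqrt u - RtoC (Tt Nt))%C);
      [now apply cder_shifted_sqrt | apply cder_Cexp].
Qed.

Lemma cdiff_f Nt x u : 0 < Re u -> den Nt x u <> 0 -> cdiff (fun u => f Nt u x) u.
Proof.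
  intros Hu Hd.
  apply (cdiff_ext (fun u => fnum Nt x u / den Nt x u)%C).
  { intros w. now rewrite f_fnum_den. }
  apply cdiff_div; [now apply cdiff_fnum | | exact Hd].
  eexists. now apply cder_den.
Qed.

Lemma cos_zero_abs v : Rabs v <= PI -> cos v = 0 -> Rabs v = PI / 2.
Proof.
  intros Hv Hc.
  assert (Hc' : cos (Rabs v) = 0).
  { unfold Rabs. destruct (Rcase_abs v); [now rewrite cos_neg | exact Hc]. }
  assert (P := Rabs_pos v).
  destruct (Rtotal_order (Rabs v) (PI / 2)) as [H | [H | H]]; [| exact H |].
  - generalize (cos_gt_0 (Rabs v)). lra.
  - generalize (cos_lt_0 (Rabs v)). generalize PI_RGT_0. lra.
Qed.

(** Write [sqrt u = p + i v]. The equation [exp (2 (p - T)) * exp (2 i v) = - x] forces [p = L] and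
    [cos (2 v) = - 1]. Since [Im u = 2 p v], the height of the contour amounts to [Rabs v <= PI],
    which leaves only [v = +- PI / 2]. *)
Lemma den_zero Nt x u : 0 < x -> 0 < Lx Nt x -> 0 < Re u ->
  Rabs (Im u) <= 2 * PI * Lx Nt x -> den Nt x u = 0 ->
  Rabs (Im u) = PI * Lx Nt x /\ Re u = Lx Nt x ^ 2 - PI ^ 2 / 4.
Proof.
  intros Hx HL Hu Hi Hd.
  assert (Hp := Re_Csqrt_pos u Hu). assert (Es := Csqrt_mul_self u).
  unfold den in Hd. destruct (Csqrt u) as [p v]. unfold Re in Hp; simpl in Hp.
  unfold Cexp, RtoC, Cplus, Cminus, Cmult, Copp in Hd; simpl in Hd.
  injection Hd as H1 H2.
  replace (2 * (p + - Tt Nt) - 0 * (v + - 0)) with (2 * (p - Tt Nt)) in H1, H2 by ring.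
  replace (2 * (v + - 0) + 0 * (p + - Tt Nt)) with (2 * v) in H1, H2 by ring.
  set (E := exp (2 * (p - Tt Nt))) in *.
  assert (PE : 0 < E) by apply exp_pos.
  assert (SC := sin2_cos2 (2 * v)). unfold Rsqr in SC.
  assert (Hs : sin (2 * v) = 0) by nra.
  assert (Hc : cos (2 * v) = - 1).
  { rewrite Hs in SC. assert (cos (2 * v) < 0) by nra. nra. }
  assert (HE : E = x) by nra.
  assert (HpL : p = Lx Nt x).
  { unfold Lx. assert (2 * (p - Tt Nt) = ln x); [| lra].
    rewrite <- HE. unfold E. now rewrite ln_exp. }
  assert (Er : Re u = p * p - v * v) by (rewrite <- Es; reflexivity).
  assert (Ei : Im u = 2 * p * v) by (rewrite <- Es; unfold Im, Cmult; simpl; ring).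
  assert (PI0 := PI_RGT_0).
  rewrite Ei, Rabs_mult, Rabs_pos_eq in * by lra.
  rewrite <- HpL in *.
  assert (Hv : Rabs v = PI / 2).
  { apply cos_zero_abs.
    - apply (Rmult_le_reg_l (2 * p)); lra.
    - rewrite cos_2a_cos in Hc. nra. }
  split.
  - rewrite Hv. field.
  - rewrite Er. replace (v * v) with (Rabs v ^ 2) by (rewrite pow2_abs; ring).
    rewrite Hv. field.
Qed.

Definition sg (up : bool) : R := if up then 1 else - 1.

(** The square of [L +- i PI / 2]; the flag treats the two conjugate poles at once. *)
Definition upole (Nt : nat) (x : R) (up : bool) : C :=
  (Lx Nt x ^ 2 - PI ^ 2 / 4, sg up * (PI * Lx Nt x)).

Lemma Csqrt_upole Nt x up : 0 < Lx Nt x ->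
  Csqrt (upole Nt x up) = (Lx Nt x, sg up * (PI / 2)).
Proof.
  intros HL. assert (PI0 := PI_RGT_0). set (L := Lx Nt x) in *.
  assert (S2 : sg up * sg up = 1) by (destruct up; simpl; ring).
  assert (M : Cmod (upole Nt x up) = L ^ 2 + PI ^ 2 / 4).
  { unfold Cmod, upole, fst, snd. fold L.
    replace ((L ^ 2 - PI ^ 2 / 4) ^ 2 + (sg up * (PI * L)) ^ 2)
      with (Rsqr (L ^ 2 + PI ^ 2 / 4)).
    - apply sqrt_Rsqr. nra.
    - unfold Rsqr. replace ((sg up * (PI * L)) ^ 2)
        with ((sg up * sg up) * (PI * L) ^ 2) by ring.
      rewrite S2. field. }
  unfold Csqrt. rewrite M. unfold upole, Re, Im, fst, snd. fold L.
  replace ((L ^ 2 + PI ^ 2 / 4 + (L ^ 2 - PI ^ 2 / 4)) / 2) with (Rsqr L)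
    by (unfold Rsqr; field).
  replace ((L ^ 2 + PI ^ 2 / 4 - (L ^ 2 - PI ^ 2 / 4)) / 2) with (Rsqr (PI / 2))
    by (unfold Rsqr; field).
  rewrite !sqrt_Rsqr by lra. f_equal. f_equal.
  assert (0 < PI * L) by nra.
  destruct up; simpl sg; destruct (Rle_dec _ _); lra.
Qed.

Lemma exp_Lx Nt x : 0 < x -> exp (Lx Nt x - Tt Nt) = sqrt x.
Proof.
  intros Hx. unfold Lx. replace (Tt Nt + / 2 * ln x - Tt Nt) with (/ 2 * ln x) by ring.
  apply Rsqr_inj; [left; apply exp_pos | apply sqrt_pos |].
  rewrite Rsqr_sqrt by lra. unfold Rsqr. rewrite <- exp_plus.
  replace (/ 2 * ln x + / 2 * ln x) with (ln x) by field. now apply exp_ln.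
Qed.

Lemma Cexp_upole Nt x up : 0 < x -> 0 < Lx Nt x ->
  Cexp (Csqrt (upole Nt x up) - RtoC (Tt Nt)) = (RtoC (sg up * sqrt x) * Ci)%C.
Proof.
  intros Hx HL. rewrite Csqrt_upole by exact HL.
  unfold Cexp, Cminus, Cplus, Copp, RtoC, Ci, Cmult, Re, Im; simpl.
  replace (Lx Nt x + - Tt Nt) with (Lx Nt x - Tt Nt) by ring.
  rewrite exp_Lx by exact Hx.
  replace (sg up * (PI / 2) + - 0) with (sg up * (PI / 2)) by ring.
  replace (cos (sg up * (PI / 2))) with 0.
  replace (sin (sg up * (PI / 2))) with (sg up).
  - f_equal; ring.
  - destruct up; simpl sg.
    + now rewrite Rmult_1_l, sin_PI2.
    + replace (- 1 * (PI / 2)) with (- (PI / 2)) by ring. now rewrite sin_neg, sin_PI2.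
  - destruct up; simpl sg.
    + now rewrite Rmult_1_l, cos_PI2.
    + replace (- 1 * (PI / 2)) with (- (PI / 2)) by ring. now rewrite cos_neg, cos_PI2.
Qed.

Lemma Cexp_double z : Cexp (2 * z) = (Cexp z * Cexp z)%C.
Proof. rewrite <- Cexp_plus. f_equal. ring. Qed.

Lemma Cexp_double_upole Nt x up : 0 < x -> 0 < Lx Nt x ->
  Cexp (2 * (Csqrt (upole Nt x up) - RtoC (Tt Nt))) = (- RtoC x)%C.
Proof.
  intros Hx HL. rewrite Cexp_double, Cexp_upole by assumption.
  assert (S2 : sg up * sg up = 1) by (destruct up; simpl; ring).
  assert (Q : sqrt x * sqrt x = x) by (apply sqrt_sqrt; lra).
  unfold Cmult, Ci, RtoC, Copp; simpl. f_equal; [| ring].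
  transitivity (- ((sg up * sg up) * (sqrt x * sqrt x))); [ring |]. rewrite S2, Q. ring.
Qed.

Lemma den_upole Nt x up : 0 < x -> 0 < Lx Nt x -> den Nt x (upole Nt x up) = 0.
Proof. intros Hx HL. unfold den. rewrite Cexp_double_upole by assumption. ring. Qed.

Lemma atan_le_id t : 0 <= t -> atan t <= t.
Proof.
  intros Ht. destruct (Req_dec t 0) as [-> | Hn]; [rewrite atan_0; lra |].
  destruct (MVT_gen atan 0 t (fun s => / (1 + s ^ 2))) as [s [Hs E]].
  - intros s _. auto_derive; [exact I | field; nra].
  - intros s _. apply continuity_pt_filterlim, (ex_derive_continuous atan).
    auto_derive. exact I.
  - rewrite atan_0, !Rminus_0_r in E. rewrite E.
    assert (/ (1 + s ^ 2) <= 1); [| nra].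
    rewrite <- Rinv_1 at 2. apply Rinv_le_contravar; nra.
Qed.

(** Machin's formula with its second arctangent dropped gives [PI / 4 < 4 * atan (1 / 5) <= 4 / 5],
    that is [PI < 3.2]. *)
Lemma PI_sqr_lt : PI ^ 2 < 11.
Proof.
  assert (H := PI_RGT_0). assert (M := Machin_4_5_239).
  assert (A1 := atan_le_id (/ 5)). assert (A2 := atan_increasing 0 (/ 239)).
  rewrite atan_0 in A2. nra.
Qed.

(** The residue of [f] at [upole]: the factor [1 / sqrt u] cancels against the derivative of the
    denominator, leaving [x / PI] times [(+- i sqrt x) / (- x)]. *)
Definition resf (x : R) (up : bool) : C := (- (RtoC (sg up * sqrt x / PI) * Ci))%C.

(** The factor [k] will be [1] for the part with [mu] and [m] for the other. The two implications on
    [c] and [d] keep the conjugate pole out of the rectangle. *)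
Lemma rectI_f_mult_upole Nt x up k B c d :
  0 < x -> 2 <= Lx Nt x -> Lx Nt x ^ 2 < B ->
  - (2 * PI * Lx Nt x) <= c -> d <= 2 * PI * Lx Nt x ->
  c < sg up * (PI * Lx Nt x) < d ->
  (sg up * (PI * Lx Nt x) < 0 -> d < PI * Lx Nt x) ->
  (0 < sg up * (PI * Lx Nt x) -> - (PI * Lx Nt x) < c) ->
  (forall z, in_rect 1 B c d z -> cdiff k z) ->
  rectI (fun u => f Nt u x * k u)%C 1 B c d
  = (2 * PI * Ci * (resf x up * k (upole Nt x up)))%C.
Proof.
  intros Hx HL HB Hc Hd Hin Hdown Hup Hk.
  assert (PI0 := PI_RGT_0). assert (PI2 := PI_sqr_lt).
  set (L := Lx Nt x) in *. set (p := upole Nt x up).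
  assert (HL0 : 0 < L) by lra.
  assert (HPL : 0 < PI * L) by nra.
  (* From [L >= 2] and [PI ^ 2 < 11] the real part of the pole exceeds [4 - 11 / 4 = 5 / 4]. *)
  assert (Rp : 1 < Re p < B) by (unfold p, upole, Re; simpl; fold L; nra).
  assert (Ip : c < Im p < d) by exact Hin.
  assert (Np : RtoC x <> 0) by (intros E; apply RtoC_inj in E; lra).
  assert (Ns := Csqrt_neq_0 p ltac:(lra)).
  rewrite (residue_simple_pole _ (fun u => fnum Nt x u * k u)%C (den Nt x) 1 B c d p
    (Cexp (2 * (Csqrt p - RtoC (Tt Nt))) / Csqrt p)%C); auto.
  - f_equal. unfold fnum, p. rewrite Cexp_upole, Cexp_double_upole by assumption. fold p.
    unfold resf.
    replace (sg up * sqrt x / PI) with (sg up * sqrt x * / PI) by reflexivity.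
    replace (x / PI) with (x * / PI) by reflexivity.
    rewrite !RtoC_mult. field. auto.
  - intros z [Z1 Z2] Hz. apply cdiff_mult; [| apply Hk; split; lra].
    apply cdiff_f; [lra |]. intros D. apply Hz.
    destruct (den_zero Nt x z) as [E1 E2]; auto; try lra.
    { apply Rabs_le. fold L. lra. }
    fold L in E1, E2. rewrite (surjective_pairing z). unfold p, upole. fold L.
    f_equal; [exact E2 |]. change (snd z) with (Im z).
    destruct up; simpl sg in *.
    + assert (- (PI * L) < c) by (apply Hup; lra).
      revert E1. unfold Rabs. destruct (Rcase_abs (Im z)); lra.
    + assert (d < PI * L) by (apply Hdown; lra).
      revert E1. unfold Rabs. destruct (Rcase_abs (Im z)); lra.
  - intros z. rewrite f_fnum_den. unfold Cdiv. ring.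
  - apply ccont_mult; [apply cdiff_ccont, cdiff_fnum; lra |].
    apply cdiff_ccont, Hk. split; lra.
  - apply cder_den. lra.
  - now apply den_upole.
  - unfold p at 1. rewrite Cexp_double_upole by assumption.
    replace (- RtoC x / Csqrt p)%C with ((- RtoC x) * / Csqrt p)%C by reflexivity.
    apply Cmult_neq_0.
    + intros E. apply Np. replace (RtoC x) with (- - RtoC x)%C by ring. rewrite E. ring.
    + intros E. apply C1_nz. rewrite <- (Cinv_r (Csqrt p)), E by exact Ns. ring.
Qed.

(** * The cotangent and its residues *)

Lemma Csin_zero w : Csin w = 0 -> Im w = 0 /\ sin (Re w) = 0.
Proof.
  intros H.
  assert (E : Cexp (Ci * w) = Cexp (- (Ci * w))).
  { apply Ceq_minus. replace (Cexp (Ci * w) - Cexp (- (Ci * w)))%C with (Csin w * (2 * Ci))%C.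
    - rewrite H. ring.
    - unfold Csin. field. apply Ci_nz. }
  assert (I0 : Im w = 0).
  (* Comparing moduli gives [exp (- Im w) = exp (Im w)]; the imaginary parts then yield the sine. *)
  { assert (M := f_equal Cmod E). rewrite !Cmod_Cexp in M. apply exp_inv in M.
    rewrite re_opp, re_mult in M. unfold Ci, Re at 1 3, Im at 1 3 in M; simpl in M. lra. }
  split; [exact I0 |].
  assert (S := f_equal Im E). destruct w as [a b]. unfold Im in I0; simpl in I0. subst b.
  unfold Cexp, Im, Re, Ci, Cmult, Copp in S; simpl in S. unfold Re; simpl.
  replace (0 * a - 1 * 0) with 0 in S by ring. replace (- 0) with 0 in S by ring.
  replace (0 * 0 + 1 * a) with a in S by ring.
  rewrite exp_0, sin_neg in S. lra.
Qed.

Lemma Cexp_Ci_R t : Cexp (Ci * RtoC t) = (RtoC (cos t) + Ci * RtoC (sin t))%C.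
Proof.
  unfold Cexp, Ci, Cmult, Cplus, RtoC, Re, Im; simpl.
  replace (0 * t - 1 * 0) with 0 by ring. replace (0 * 0 + 1 * t) with t by ring.
  rewrite exp_0. f_equal; ring.
Qed.

Lemma Cexp_opp_Ci_R t : Cexp (- (Ci * RtoC t)) = (RtoC (cos t) - Ci * RtoC (sin t))%C.
Proof.
  replace (- (Ci * RtoC t))%C with (Ci * RtoC (- t))%C by (rewrite RtoC_opp; ring).
  rewrite Cexp_Ci_R, cos_neg, sin_neg, RtoC_opp. ring.
Qed.

Lemma Csin_R t : Csin (RtoC t) = RtoC (sin t).
Proof. unfold Csin. rewrite Cexp_Ci_R, Cexp_opp_Ci_R. field. apply Ci_nz. Qed.

Lemma Ccos_R t : Ccos (RtoC t) = RtoC (cos t).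
Proof. unfold Ccos. rewrite Cexp_Ci_R, Cexp_opp_Ci_R. field. Qed.

Lemma cder_Cexp_lin (k w : C) : cder (fun w => Cexp (k * w)) w (Cexp (k * w) * k)%C.
Proof.
  apply (cder_comp Cexp (fun w => k * w)%C); [| apply cder_Cexp].
  assert (H := cder_scal k _ _ _ (cder_id w)). now rewrite Cmult_1_r in H.
Qed.

Lemma cder_Csin w : cder Csin w (Ccos w).
Proof.
  apply (cder_ext (fun w => / (2 * Ci) * (Cexp (Ci * w) + - 1 * Cexp (- Ci * w)))%C).
  { intros u. unfold Csin, Cdiv. replace (- Ci * u)%C with (- (Ci * u))%C by ring. ring. }
  replace (Ccos w) with
    (/ (2 * Ci) * (Cexp (Ci * w) * Ci + - 1 * (Cexp (- Ci * w) * - Ci)))%C.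
  - apply cder_scal. apply cder_plus; [apply cder_Cexp_lin |].
    apply cder_scal, cder_Cexp_lin.
  - unfold Ccos. replace (- Ci * w)%C with (- (Ci * w))%C by ring.
    field. apply Ci_nz.
Qed.

Lemma cdiff_Ccos w : cdiff Ccos w.
Proof.
  apply (cdiff_ext (fun w => / 2 * (Cexp (Ci * w) + Cexp (- Ci * w)))%C).
  { intros u. unfold Ccos, Cdiv. replace (- Ci * u)%C with (- (Ci * u))%C by ring. ring. }
  eexists. apply cder_scal. apply cder_plus; apply cder_Cexp_lin.
Qed.

(** More than positivity is needed: vertical edges are shifted by [1] from the multiples of [h], and
    the shift must be less than a period to avoid the next pole. *)
Lemma h_pos : 1 < h.
Proof. unfold h. generalize PI2_3_2. nra. Qed.

Lemma cder_scaled (u : C) :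
  cder (fun u => RtoC PI * u / RtoC h)%C u (RtoC (PI / h)).
Proof.
  assert (Hh := h_pos).
  apply (cder_ext (fun u => RtoC (PI / h) * u)%C).
  { intros w. rewrite RtoC_div by lra. unfold Cdiv. ring. }
  assert (H := cder_scal (RtoC (PI / h)) _ _ _ (cder_id u)). now rewrite Cmult_1_r in H.
Qed.

Lemma scaled_components (u : C) :
  Re (RtoC PI * u / RtoC h) = PI * Re u / h /\ Im (RtoC PI * u / RtoC h) = PI * Im u / h.
Proof.
  assert (Hh := h_pos).
  replace (RtoC PI * u / RtoC h)%C with (RtoC (PI / h) * u)%C
    by (rewrite RtoC_div by lra; unfold Cdiv; ring).
  rewrite re_scal_l, im_scal_l. split; field; lra.
Qed.

Lemma cdiff_m u : Csin (RtoC PI * u / RtoC h) <> 0 -> cdiff m u.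
Proof.
  intros H. apply cdiff_mult; [eexists; apply cder_const |].
  apply (cdiff_div (fun u => Ccos (RtoC PI * u / RtoC h)) (fun u => Csin (RtoC PI * u / RtoC h)));
    [| | exact H].
  - destruct (cdiff_Ccos (RtoC PI * u / RtoC h)) as [l Hl].
    eexists. apply (cder_comp Ccos (fun u => RtoC PI * u / RtoC h)%C);
      [apply cder_scaled | exact Hl].
  - eexists. apply (cder_comp Csin (fun u => RtoC PI * u / RtoC h)%C);
      [apply cder_scaled | apply cder_Csin].
Qed.

Lemma sin_scaled_zero n t : INR n * h < t < (INR n + 2) * h -> sin (PI * t / h) = 0 ->
  t = (INR n + 1) * h.
Proof.
  intros Ht Hs. assert (Hh := h_pos). assert (PI0 := PI_RGT_0).
  destruct (sin_eq_0_0 _ Hs) as [k Hk].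
  assert (Et : t = IZR k * h).
  { apply (Rmult_eq_reg_l (PI / h)).
    - replace (PI / h * t) with (PI * t / h) by (field; lra). rewrite Hk. field. lra.
    - apply Rgt_not_eq, Rdiv_lt_0_compat; lra. }
  rewrite Et. f_equal. rewrite Et in Ht. rewrite INR_IZR_INZ in *.
  assert (H1 : IZR (Z.of_nat n) < IZR k) by (apply (Rmult_lt_reg_r h); lra).
  assert (H2 : IZR k < IZR (Z.of_nat n) + 2) by (apply (Rmult_lt_reg_r h); lra).
  rewrite <- plus_IZR in *. apply lt_IZR in H1. apply lt_IZR in H2. f_equal. lia.
Qed.

Lemma sin_scaled_multiple n : sin (PI * ((INR n + 1) * h) / h) = 0.
Proof.
  assert (Hh := h_pos). apply sin_eq_0_1. exists (Z.of_nat n + 1)%Z.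
  rewrite plus_IZR, <- INR_IZR_INZ. field. lra.
Qed.

(** At the only pole of the strip, [m] has residue [- i h / (2 PI)], and [2 PI i] times this is
    [h]. *)
Lemma rectI_mult_m_strip (F : C -> C) n b : 0 < b ->
  (forall z, in_rect (INR n * h + 1) ((INR n + 1) * h + 1) (- b) b z -> cdiff F z) ->
  rectI (fun u => F u * m u)%C (INR n * h + 1) ((INR n + 1) * h + 1) (- b) b
  = (RtoC h * F (RtoC ((INR n + 1) * h)))%C.
Proof.
  intros Hb HF. assert (Hh := h_pos). assert (PI0 := PI_RGT_0).
  set (p := RtoC ((INR n + 1) * h)).
  assert (Ep : (RtoC PI * p / RtoC h)%C = RtoC (PI * ((INR n + 1) * h) / h)).
  { unfold p. now rewrite <- RtoC_mult, <- RtoC_div by lra. }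
  assert (Sp := sin_scaled_multiple n).
  assert (Cp : Ccos (RtoC PI * p / RtoC h) <> 0).
  { rewrite Ep, Ccos_R. intros E. apply RtoC_inj in E.
    generalize (sin2_cos2 (PI * ((INR n + 1) * h) / h)). rewrite Sp, E. unfold Rsqr. lra. }
  assert (Rp : INR n * h + 1 < Re p < (INR n + 1) * h + 1).
  { unfold p, Re, RtoC; simpl. lra. }
  assert (Ip : - b < Im p < b) by (unfold p, Im, RtoC; simpl; lra).
  assert (NPI : RtoC PI <> 0) by (intros E; apply RtoC_inj in E; lra).
  assert (Nh : RtoC h <> 0) by (intros E; apply RtoC_inj in E; lra).
  assert (Cosd : cdiff (fun u => Ccos (RtoC PI * u / RtoC h)) p).
  { destruct (cdiff_Ccos (RtoC PI * p / RtoC h)) as [l Hl].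
    eexists. apply (cder_comp Ccos (fun u => RtoC PI * u / RtoC h)%C);
      [apply cder_scaled | exact Hl]. }
  rewrite (residue_simple_pole _
    (fun u => F u * (- (Ci / 2) * Ccos (RtoC PI * u / RtoC h)))%C
    (fun u => Csin (RtoC PI * u / RtoC h)) _ _ _ _ p
    (Ccos (RtoC PI * p / RtoC h) * RtoC (PI / h))%C); auto.
  - rewrite RtoC_div by lra.
    transitivity (- (Ci * Ci) * (RtoC h * F p))%C.
    { field. auto. }
    replace (Ci * Ci)%C with (- (1))%C; [ring |].
    unfold Ci, Cmult, Copp, RtoC; simpl. f_equal; ring.
  - intros z [Z1 Z2] Hz. apply cdiff_mult; [apply HF; split; lra |].
    apply cdiff_m. intros E. apply Csin_zero in E. destruct E as [E1 E2].
    destruct (scaled_components z) as [K1 K2]. rewrite K1 in E2. rewrite K2 in E1.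
    apply Hz. rewrite (surjective_pairing z). unfold p, RtoC. f_equal.
    + apply (sin_scaled_zero n); [| exact E2]. change (fst z) with (Re z). lra.
    + change (snd z) with (Im z).
      apply (Rmult_eq_reg_l (PI / h)); [| apply Rgt_not_eq, Rdiv_lt_0_compat; lra].
      replace (PI / h * Im z) with (PI * Im z / h) by (field; lra). rewrite E1. ring.
  - intros z. unfold m, Ccot, Cdiv. ring.
  - apply ccont_mult; [apply cdiff_ccont, HF; split; lra |].
    apply ccont_mult; [apply ccont_const | now apply cdiff_ccont].
  - apply (cder_comp Csin (fun u => RtoC PI * u / RtoC h)%C);
      [apply cder_scaled | apply cder_Csin].
  - rewrite Ep, Csin_R, Sp. reflexivity.
  - apply Cmult_neq_0; [exact Cp |]. intros E. apply RtoC_inj in E.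
    generalize (Rdiv_lt_0_compat PI h). lra.
Qed.

(** * Evaluation of the contour integral *)

Lemma mu_lower X s : s < 0 -> mu (X, s) = RtoC (1 / 2).
Proof. intros H. unfold mu, Im; simpl. destruct (Rle_dec 0 s); [lra | reflexivity]. Qed.

Lemma mu_upper X s : 0 <= s -> mu (X, s) = RtoC (- 1 / 2).
Proof. intros H. unfold mu, Im; simpl. destruct (Rle_dec 0 s); [reflexivity | lra]. Qed.

(** The interval is split at the jump of [mu]. Integrands need to agree only inside each half, so
    the value of [mu] at height [0] does not matter. *)
Lemma is_CInt_mult_mu_vertical F X a : 0 < a ->
  (forall s, - a <= s <= a -> ccont F (X, s)) ->
  is_CInt (fun s => F (X, s) * mu (X, s))%C (- a) a
    (RtoC (1 / 2) * CInt (fun s => F (X, s)) (- a) 0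
     + RtoC (- 1 / 2) * CInt (fun s => F (X, s)) 0 a)%C.
Proof.
  intros Ha HF.
  apply (@is_RInt_Chasles C_R_NormedModule _ (- a) 0 a).
  - apply (@is_RInt_ext C_R_NormedModule (fun s => RtoC (1 / 2) * F (X, s))%C).
    + intros s Hs. rewrite Rmax_right in Hs by lra. rewrite mu_lower by lra.
      apply Cmult_comm.
    + apply is_CInt_cmult, CInt_correct, (ex_CInt_vertical F); [lra |].
      intros s Hs. apply HF. lra.
  - apply (@is_RInt_ext C_R_NormedModule (fun s => RtoC (- 1 / 2) * F (X, s))%C).
    + intros s Hs. rewrite Rmin_left in Hs by lra. rewrite mu_upper by lra.
      apply Cmult_comm.
    + apply is_CInt_cmult, CInt_correct, (ex_CInt_vertical F); [lra |].
      intros s Hs. apply HF. lra.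
Qed.

Lemma CInt_mult_delta_vertical F X a : 0 < a ->
  (forall s, - a <= s <= a -> ccont F (X, s)) ->
  (forall s, - a <= s <= a -> ccont (fun u => F u * m u)%C (X, s)) ->
  CInt (fun s => F (X, s) * delta (X, s))%C (- a) a
  = (RtoC (1 / 2) * CInt (fun s => F (X, s)) (- a) 0
     + RtoC (- 1 / 2) * CInt (fun s => F (X, s)) 0 a
     - CInt (fun s => F (X, s) * m (X, s)) (- a) a)%C.
Proof.
  intros Ha HF HM. assert (HI := is_CInt_mult_mu_vertical F X a Ha HF).
  rewrite (CInt_eq _ (fun s => F (X, s) * mu (X, s) - F (X, s) * m (X, s))%C).
  - rewrite CInt_minus.
    + now rewrite (is_CInt_unique _ _ _ _ HI).
    + eexists. exact HI.
    + apply (ex_CInt_vertical (fun u => F u * m u)%C); [lra | exact HM].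
  - intros s. unfold delta. ring.
Qed.

Lemma CInt_mult_delta_horizontal F (k : C) A B y : A <= B ->
  (forall t, mu (t, y) = k) ->
  (forall t, A <= t <= B -> ccont F (t, y)) ->
  (forall t, A <= t <= B -> ccont (fun u => F u * m u)%C (t, y)) ->
  CInt (fun t => F (t, y) * delta (t, y))%C A B
  = (k * CInt (fun t => F (t, y)) A B - CInt (fun t => F (t, y) * m (t, y)) A B)%C.
Proof.
  intros HAB Hk HF HM.
  assert (H1 := ex_CInt_horizontal F A B y HAB HF).
  assert (H2 := ex_CInt_horizontal (fun u => F u * m u)%C A B y HAB HM).
  rewrite (CInt_eq _ (fun t => k * F (t, y) - F (t, y) * m (t, y))%C).
  - rewrite CInt_minus; [now rewrite CInt_cmult | | exact H2].
    eexists. apply is_CInt_cmult, CInt_correct, H1.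
  - intros t. unfold delta. rewrite Hk. ring.
Qed.

(* The jump of [mu] across the real axis produces the integral along the axis. *)
Lemma rectI_mult_delta F A B a : 0 < a -> A <= B ->
  (forall z, on_bd A B (- a) a z -> ccont F z) ->
  (forall z, on_bd A B (- a) a z -> ccont (fun u => F u * m u)%C z) ->
  rectI (fun u => F u * delta u)%C A B (- a) a
  = (CInt (fun t => F (t, 0)) A B
     + RtoC (1 / 2) * rectI F A B (- a) 0 + RtoC (- 1 / 2) * rectI F A B 0 a
     - rectI (fun u => F u * m u) A B (- a) a)%C.
Proof.
  intros Ha HAB HF HM. unfold rectI.
  rewrite (CInt_mult_delta_vertical F A a), (CInt_mult_delta_vertical F B a),
    (CInt_mult_delta_horizontal F (RtoC (1 / 2)) A B (- a)),
    (CInt_mult_delta_horizontal F (RtoC (- 1 / 2)) A B a);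
    try assumption;
    try (intros t Ht; (apply HF || apply HM); on_bd_tac);
    try (intros t; (apply mu_lower || apply mu_upper); lra).
  rewrite !RtoC_div by lra. field.
Qed.

Lemma rectI_degenerate F A c d : rectI F A A c d = 0.
Proof.
  unfold rectI.
  assert (Z : forall g, CInt g A A = RtoC 0)
    by (intros g; exact (@RInt_point C_R_CompleteNormedModule A g)).
  rewrite !Z. ring.
Qed.

Lemma Csin_scaled_neq_0 u : Im u <> 0 \/ sin (PI * Re u / h) <> 0 ->
  Csin (RtoC PI * u / RtoC h) <> 0.
Proof.
  intros H E. apply Csin_zero in E. destruct (scaled_components u) as [K1 K2].
  rewrite K1, K2 in E. destruct E as [E1 E2].
  destruct H as [H | H]; [| contradiction]. apply H.
  assert (Hh := h_pos). assert (PI0 := PI_RGT_0).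
  apply (Rmult_eq_reg_l (PI / h)); [| apply Rgt_not_eq, Rdiv_lt_0_compat; lra].
  replace (PI / h * Im u) with (PI * Im u / h) by (field; lra). rewrite E1. ring.
Qed.

Lemma sin_scaled_shift_neq_0 n : sin (PI * (INR n * h + 1) / h) <> 0.
Proof.
  intros E. assert (Hh := h_pos).
  apply (sin_scaled_zero n) in E; lra.
Qed.

(** Each induction step appends one strip on the right. The values of [F] at the poles enter as a
    real sequence [g], so that the result is a sum over [R]. *)
Lemma rectI_mult_m (F : C -> C) (g : nat -> R) n b : 0 < b ->
  (forall j, (1 <= j)%nat -> F (RtoC (INR j * h)) = RtoC (g j)) ->
  (forall z, 1 <= Re z -> - b <= Im z <= b -> cdiff F z) ->
  rectI (fun u => F u * m u)%C 1 (INR n * h + 1) (- b) b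
  = RtoC (h * sum_n_m g 1 n).
Proof.
  intros Hb Hg HF. assert (Hh := h_pos).
  assert (Hc : forall t y, 1 <= t -> y = b \/ y = - b ->
    ccont (fun u => F u * m u)%C (t, y)).
  { intros t y Ht Hy. apply ccont_mult; apply cdiff_ccont.
    - apply HF; unfold Re, Im; simpl; [exact Ht | destruct Hy; lra].
    - apply cdiff_m, Csin_scaled_neq_0. left. unfold Im; simpl. destruct Hy; lra. }
  induction n as [| n IH].
  (* For [n = 0] the rectangle has width zero and the sum from [1] to [0] is empty. *)
  - replace (INR 0 * h + 1) with 1 by (simpl; ring).
    rewrite rectI_degenerate, sum_n_m_zero by auto.
    unfold zero; simpl. f_equal. ring.
  - assert (Hn := pos_INR n).
    rewrite (rectI_split_vertical _ 1 (INR n * h + 1) (INR (S n) * h + 1)).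
    + rewrite IH, S_INR, rectI_mult_m_strip; [| exact Hb |].
      * rewrite <- S_INR, Hg by apply le_n_S, Nat.le_0_l.
        rewrite sum_n_Sm by apply le_n_S, Nat.le_0_l.
        rewrite <- RtoC_mult, <- RtoC_plus. f_equal. unfold plus; simpl. ring.
      * intros z [Z1 Z2]. apply HF; [nra | exact Z2].
    + rewrite S_INR. nra.
    + intros t Ht. apply Hc; [lra | now right].
    + intros t Ht. apply Hc; [lra | now left].
Qed.

(** * The function [f] on the real axis *)

Definition freal (Nt : nat) (x t : R) : R :=
  x / PI * / sqrt t * (exp (sqrt t - Tt Nt) / (exp (2 * (sqrt t - Tt Nt)) + x)).

Lemma Csqrt_R t : 0 <= t -> Csqrt (RtoC t) = RtoC (sqrt t).
Proof.
  intros Ht. unfold Csqrt. rewrite Cmod_R, Rabs_pos_eq by exact Ht.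
  unfold RtoC, Re, Im; simpl.
  replace ((t + t) / 2) with t by field. replace ((t - t) / 2) with 0 by field.
  rewrite sqrt_0. f_equal. ring.
Qed.

Lemma f_R Nt x t : 0 < x -> 0 < t -> f Nt (RtoC t) x = RtoC (freal Nt x t).
Proof.
  intros Hx Ht. assert (Hs := sqrt_lt_R0 t Ht).
  unfold f, freal. rewrite Csqrt_R by lra.
  rewrite <- RtoC_minus, Cexp_R, <- RtoC_mult, Cexp_R, <- RtoC_plus.
  rewrite <- RtoC_inv by lra. rewrite <- RtoC_div.
  - now rewrite <- !RtoC_mult.
  - generalize (exp_pos (2 * (sqrt t - Tt Nt))). lra.
Qed.

Lemma r_t_freal Nt x : r_t Nt x = h * sum_n_m (fun j => freal Nt x (INR j * h)) 1 Nt.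
Proof.
  unfold r_t. fold (Tt Nt).
  rewrite <- !(sum_n_m_mult_l (K := R_Ring)).
  apply sum_n_m_ext. intros j. unfold mult; simpl. unfold freal.
  replace (2 * sqrt (INR j * h) - 2 * Tt Nt) with (2 * (sqrt (INR j * h) - Tt Nt)) by ring.
  unfold Rdiv. ring.
Qed.

(** A primitive of [freal]: substituting [y = exp (sqrt t - T)] turns [freal dt] into
    [(2 x / PI) dy / (y^2 + x)]. *)
Definition fprim (Nt : nat) (x t : R) : R :=
  sqrt x * (2 / PI) * atan (exp (sqrt t - Tt Nt) / sqrt x).

Lemma is_RInt_freal Nt x B : 0 < x -> 1 <= B ->
  is_RInt (freal Nt x) 1 B (fprim Nt x B - fprim Nt x 1).
Proof.
  intros Hx HB. assert (PI0 := PI_RGT_0).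
  assert (Hs := sqrt_lt_R0 x Hx).
  apply (@is_RInt_derive R_CompleteNormedModule (fprim Nt x)).
  - intros t Ht. rewrite Rmin_left in Ht by exact HB.
    assert (Hst := sqrt_lt_R0 t ltac:(lra)).
    unfold fprim. auto_derive; [lra |].
    unfold freal. replace (exp (2 * (sqrt t - Tt Nt)))
      with (exp (sqrt t - Tt Nt) * exp (sqrt t - Tt Nt))
      by (rewrite <- exp_plus; f_equal; ring).
    change (sqrt t + - Tt Nt) with (sqrt t - Tt Nt).
    assert (Hy := exp_pos (sqrt t - Tt Nt)).
    set (y := exp (sqrt t - Tt Nt)) in *.
    assert (Ex : sqrt x * sqrt x = x) by (apply sqrt_sqrt; lra).
    set (s := sqrt x) in *. clearbody s. rewrite <- Ex.
    field. repeat split; nra.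
  - intros t Ht. rewrite Rmin_left in Ht by exact HB.
    assert (Hst := sqrt_lt_R0 t ltac:(lra)).
    apply (ex_derive_continuous (freal Nt x)). unfold freal. auto_derive.
    generalize (exp_pos (2 * (sqrt t + - Tt Nt))). intros.
    repeat split; lra.
Qed.

Lemma Tt_sqr Nt : 4 * Tt Nt ^ 2 = INR Nt * h.
Proof.
  unfold Tt. assert (Hh := h_pos). assert (Hn := pos_INR Nt).
  replace (sqrt (INR Nt * h / 4) ^ 2) with (sqrt (INR Nt * h / 4) * sqrt (INR Nt * h / 4)) by ring.
  rewrite sqrt_sqrt; [field | nra].
Qed.

Lemma Tt_ge_0 Nt : 0 <= Tt Nt.
Proof. apply sqrt_pos. Qed.

Theorem Gamma_integral_formula Nt x : 0 < x <= 1 -> 2 <= Lx Nt x ->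
  Gamma_integral Nt x
  = (RtoC (fprim Nt x (4 * Tt Nt ^ 2 + 1) - fprim Nt x 1 - r_t Nt x)
     + 2 * PI * Ci * (resf x true * delta (upole Nt x true)
                      + resf x false * delta (upole Nt x false)))%C.
Proof.
  intros [Hx Hx1] HL. assert (Hh := h_pos). assert (PI0 := PI_RGT_0).
  assert (PI2 := PI_sqr_lt).
  assert (HLT : Lx Nt x <= Tt Nt).
  { unfold Lx. assert (ln x <= 0); [| lra].
    rewrite <- ln_1. now apply ln_le. }
  unfold Gamma_integral. set (B := 4 * Tt Nt ^ 2 + 1).
  assert (EB : B = INR Nt * h + 1) by (unfold B; now rewrite Tt_sqr).
  assert (HB : Lx Nt x ^ 2 < B) by (unfold B; nra).
  assert (HB1 : 1 < B) by nra.
  change (Tt Nt + / 2 * ln x) with (Lx Nt x).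
  set (L := Lx Nt x) in *. set (a := 2 * PI * L).
  assert (HPL : 0 < PI * L) by nra.
  assert (Ha : 0 < a) by (unfold a; nra).
  assert (Ea : a = 2 * (PI * L)) by (unfold a; ring).
  change (rect_integral (fun u => (f Nt u x * delta u)%C) 1 B a)
    with (rectI (fun u => (f Nt u x * delta u)%C) 1 B (- a) a).
  (* The poles of [f] have real part strictly between [1] and [B], so the vertical edges avoid them
     at every height. *)
  assert (Reg : forall z, 1 <= Re z -> - a <= Im z <= a ->
    Re z = 1 \/ Re z = B \/ Rabs (Im z) <> PI * L -> cdiff (fun u => f Nt u x) z).
  { intros z Z1 Z2 Z3. apply cdiff_f; [lra |]. intros D.
    destruct (den_zero Nt x z) as [E1 E2]; fold L; fold a; try lra; try assumption.
    - apply Rabs_le. lra.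
    - fold L in E1, E2. destruct Z3 as [Z3 | [Z3 | Z3]]; [nra | nra | contradiction]. }
  assert (Regm : forall z, Re z = 1 \/ Re z = B \/ Im z <> 0 -> cdiff m z).
  { intros z Hz. apply cdiff_m, Csin_scaled_neq_0.
    destruct Hz as [Hz | [Hz | Hz]]; [right | right | now left]; rewrite Hz.
    - assert (N := sin_scaled_shift_neq_0 0). simpl in N.
      now rewrite Rmult_0_l, Rplus_0_l in N.
    - rewrite EB. apply sin_scaled_shift_neq_0. }
  assert (Bd : forall z, on_bd 1 B (- a) a z ->
    cdiff (fun u => f Nt u x) z /\ cdiff m z).
  { intros z [[Z1 Z2] Z3]. split.
    - apply Reg; [lra | lra |]. destruct Z3 as [Z3 | [Z3 | [Z3 | Z3]]]; auto; right; right;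
        rewrite Z3; unfold Rabs; destruct (Rcase_abs _); lra.
    - apply Regm. destruct Z3 as [Z3 | [Z3 | [Z3 | Z3]]]; auto; right; right; lra. }
  rewrite (rectI_mult_delta (fun u => f Nt u x)); [| exact Ha | lra | |].
  2: { intros z Hz. apply cdiff_ccont, (Bd z Hz). }
  2: { intros z Hz. apply cdiff_ccont, cdiff_mult; apply (Bd z Hz). }
  (* With a factor [1] inserted, the residue lemma for [f * k] also covers the halves on which [mu]
     is constant. *)
  assert (One : forall c d, c <= d -> rectI (fun u => f Nt u x) 1 B c d
    = rectI (fun u => f Nt u x * 1)%C 1 B c d).
  { intros c d Hcd. apply rectI_ext; [lra | exact Hcd |]. intros. ring. }
  assert (C1 : forall z, cdiff (fun _ : C => RtoC 1) z).
  { intros z. eexists. apply cder_const. }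
  assert (Upper : rectI (fun u => f Nt u x) 1 B 0 a = (2 * PI * Ci * (resf x true * 1))%C).
  { rewrite One by lra.
    apply (rectI_f_mult_upole Nt x true (fun _ => RtoC 1)); auto; simpl sg; fold L; lra. }
  assert (Lower : rectI (fun u => f Nt u x) 1 B (- a) 0 = (2 * PI * Ci * (resf x false * 1))%C).
  { rewrite One by lra.
    apply (rectI_f_mult_upole Nt x false (fun _ => RtoC 1)); auto; simpl sg; fold L; lra. }
  (* Halfway between the axis, which carries the poles of [m], and the height [PI L] of the upper
     pole of [f]. *)
  set (b := PI * L / 2).
  assert (Hb : 0 < b) by (unfold b; lra).
  assert (Upperm : rectI (fun u => f Nt u x * m u)%C 1 B b a
    = (2 * PI * Ci * (resf x true * m (upole Nt x true)))%C).
  { apply (rectI_f_mult_upole Nt x true m); auto; simpl sg; fold L; try (unfold b; lra).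
    intros z [_ Z]. apply Regm. right; right; lra. }
  assert (Lowerm : rectI (fun u => f Nt u x * m u)%C 1 B (- a) (- b)
    = (2 * PI * Ci * (resf x false * m (upole Nt x false)))%C).
  { apply (rectI_f_mult_upole Nt x false m); auto; simpl sg; fold L; try (unfold b; lra).
    intros z [_ Z]. apply Regm. right; right; lra. }
  assert (Middle : rectI (fun u => f Nt u x * m u)%C 1 B (- b) b = RtoC (r_t Nt x)).
  { rewrite EB, r_t_freal.
    apply (rectI_mult_m (fun u => f Nt u x)); [exact Hb | |].
    - intros j Hj. apply f_R; [exact Hx |].
      apply Rmult_lt_0_compat; [apply lt_0_INR, Hj | lra].
    - intros z Z1 Z2. apply Reg; [exact Z1 | unfold b in Z2; lra |].
      right; right. assert (Rabs (Im z) <= b) by (apply Rabs_le; lra). unfold b in *; lra. }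
  assert (Edge : forall X s, X = 1 \/ X = B -> - a <= s <= a ->
    ccont (fun u => f Nt u x * m u)%C (X, s)).
  { intros X s HX Hs. apply cdiff_ccont, cdiff_mult; apply Bd; unfold on_bd, in_rect;
      simpl; (split; [destruct HX; lra | tauto]). }
  rewrite (rectI_split_horizontal _ 1 B (- a) (- b) a), (rectI_split_horizontal _ 1 B (- b) b a);
    try (unfold b; lra);
    try (intros s Hs; apply Edge; [tauto | unfold b in Hs; lra]).
  rewrite Upper, Lower, Upperm, Lowerm, Middle.
  rewrite (is_CInt_unique _ _ _ (RtoC (fprim Nt x B - fprim Nt x 1))).
  2: { apply is_CInt_components.
       - apply (is_RInt_ext (freal Nt x)); [| apply is_RInt_freal; lra].
         intros t Ht. rewrite Rmin_left in Ht by lra.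
         change ((t, 0) : C) with (RtoC t). now rewrite f_R by lra.
       - apply (is_RInt_ext (fun _ => 0)); [| apply is_RInt_zero].
         intros t Ht. rewrite Rmin_left in Ht by lra.
         change ((t, 0) : C) with (RtoC t). now rewrite f_R by lra. }
  (* Only the arguments of [mu] are opened; their heights [+- PI L] decide its value, and [- 1 / 2]
     and [1 / 2] match the weights of the upper and lower halves. *)
  unfold delta. unfold upole at 3 5. rewrite mu_upper, mu_lower by (simpl sg; fold L; lra).
  rewrite (RtoC_minus _ (r_t Nt x)), !RtoC_div by lra. field.
Qed.

(** * Bounds on the residue terms and on the integral along the axis *)

Lemma Cmod_div_minus_le (a b : C) : Cmod a < Cmod b ->
  Cmod (a / (b - a)) <= Cmod a / (Cmod b - Cmod a).
Proof.
  intros H. assert (P := Cmod_triangle_rev b a).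
  rewrite Cmod_div by (apply Cmod_gt_0; lra).
  apply Rmult_le_compat_l; [apply Cmod_ge_0 |]. apply Rinv_le_contravar; lra.
Qed.

(** With [e1 = exp (i z)], [e2 = exp (- i z)] and [z = PI u / h], [m] equals
    [(e1 + e2) / (2 (e1 - e2))]. Subtracting it from [mu] cancels the growing exponential in the
    numerator: [delta] is [e1 / (e2 - e1)] above the axis and [- e2 / (e1 - e2)] below. *)
Lemma Cmod_delta_le u v : 0 < v -> Rabs (PI * Im u / h) = v ->
  Cmod (delta u) <= / (exp (2 * v) - 1).
Proof.
  intros Hv E. assert (Hh := h_pos). assert (PI0 := PI_RGT_0).
  destruct (scaled_components u) as [_ K].
  set (z := (RtoC PI * u / RtoC h)%C) in *.
  assert (M1 : Cmod (Cexp (Ci * z)) = exp (- Im z)).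
  { rewrite Cmod_Cexp, re_mult. f_equal. unfold Ci, Re at 1, Im at 1; simpl. ring. }
  assert (M2 : Cmod (Cexp (- (Ci * z))) = exp (Im z)).
  { rewrite Cmod_Cexp, re_opp, re_mult. f_equal. unfold Ci, Re at 1, Im at 1; simpl. ring. }
  assert (Lt : exp (- v) < exp v) by (apply exp_increasing; lra).
  assert (Fr : exp (- v) / (exp v - exp (- v)) = / (exp (2 * v) - 1)).
  { replace (2 * v) with (v + v) by ring. rewrite exp_plus, exp_Ropp.
    assert (P := exp_pos v).
    assert (1 < exp v) by (rewrite <- exp_0; now apply exp_increasing).
    field. repeat split; nra. }
  assert (Hi : Im u = h / PI * Im z) by (rewrite K; field; lra).
  assert (Hp : 0 < h / PI) by (apply Rdiv_lt_0_compat; lra).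
  set (e1 := Cexp (Ci * z)) in *. set (e2 := Cexp (- (Ci * z))) in *.
  assert (Em : e1 <> e2 -> (m u = (e1 + e2) / (2 * (e1 - e2)))%C).
  { intros N. unfold m, Ccot, Ccos, Csin. fold z. fold e1 e2.
    assert (N' := Cminus_eq_contra _ _ N).
    replace (- (Ci / 2) * ((e1 + e2) / 2 / ((e1 - e2) / (2 * Ci))))%C
      with (- (Ci * Ci) * ((e1 + e2) / (2 * (e1 - e2))))%C
      by (field; split; [apply Ci_nz | exact N']).
    replace (Ci * Ci)%C with (- (1))%C; [ring |].
    unfold Ci, Cmult, Copp, RtoC; simpl. f_equal; ring. }
  rewrite <- K in E. revert E. unfold Rabs. destruct (Rcase_abs (Im z)) as [S | S]; intros E.
  - replace (Im z) with (- v) in M1, M2, Hi by lra. rewrite Ropp_involutive in M1.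
    assert (N : e1 <> e2) by (intros Z; rewrite Z in M1; lra).
    assert (N' := Cminus_eq_contra _ _ N).
    replace (delta u) with (- (e2 / (e1 - e2)))%C.
    + rewrite Cmod_opp, <- Fr, <- M1, <- M2. apply Cmod_div_minus_le. lra.
    + unfold delta. rewrite (Em N), (surjective_pairing u).
      rewrite mu_lower by (change (snd u) with (Im u); nra).
      rewrite RtoC_div by lra. field. exact N'.
  - replace (Im z) with v in M1, M2, Hi by lra.
    assert (N : e1 <> e2) by (intros Z; rewrite Z in M1; lra).
    assert (N' := Cminus_eq_contra _ _ N).
    assert (N2 := Cminus_eq_contra _ _ (not_eq_sym N)).
    replace (delta u) with (e1 / (e2 - e1))%C.
    + rewrite <- Fr, <- M1, <- M2. apply Cmod_div_minus_le. lra.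
    + unfold delta. rewrite (Em N), (surjective_pairing u).
      rewrite mu_upper by (change (snd u) with (Im u); nra).
      rewrite RtoC_div by lra. field. split; assumption.
Qed.

Lemma exp_Lx_mult Nt x : 0 < x -> exp (Lx Nt x) = sqrt x * exp (Tt Nt).
Proof.
  intros Hx. rewrite <- (exp_Lx Nt x Hx), <- exp_plus. f_equal. ring.
Qed.

Lemma exp_le_compat (a b : R) : a <= b -> exp a <= exp b.
Proof. intros [H | ->]; [left; now apply exp_increasing | lra]. Qed.

(** Four factors [exp (1 / 2) >= 3 / 2] give [81 / 16]. *)
Lemma exp_2_ge : 5 <= exp 2.
Proof.
  assert (H := exp_ineq1_le (/ 2)).
  replace 2 with (/ 2 + / 2 + (/ 2 + / 2)) by field. rewrite !exp_plus.
  assert (2.25 <= exp (/ 2) * exp (/ 2)) by nra. nra.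
Qed.

(** The residue contributes [sqrt x] and [delta] contributes about [exp (- L)]. Since
    [exp L = sqrt x * exp T], the dependence on [x] cancels. *)
Lemma Cmod_residue_term_le Nt x up : 0 < x -> 2 <= Lx Nt x ->
  Cmod (resf x up * delta (upole Nt x up)) <= 5 / 4 * exp (- Tt Nt) / PI.
Proof.
  intros Hx HL. assert (Hh := h_pos). assert (PI0 := PI_RGT_0).
  assert (Hs := sqrt_lt_R0 x Hx).
  assert (D : Cmod (delta (upole Nt x up)) <= / (exp (Lx Nt x) - 1)).
  { replace (Lx Nt x) with (2 * (Lx Nt x / 2)) by field.
    apply Cmod_delta_le; [lra |].
    unfold upole, Im; simpl.
    (* Here the choice [h = 2 PI^2] enters: [PI * PI L / h = L / 2]. *)
    replace (PI * (sg up * (PI * Lx Nt x)) / h) with (sg up * (Lx Nt x / 2))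
      by (unfold h; field; lra).
    rewrite Rabs_mult, (Rabs_pos_eq (Lx Nt x / 2)) by lra.
    replace (Rabs (sg up)) with 1; [ring |].
    destruct up; simpl sg; unfold Rabs; destruct (Rcase_abs _); lra. }
  assert (R : Cmod (resf x up) = sqrt x / PI).
  { unfold resf. rewrite Cmod_opp, Cmod_mult, Cmod_Ci, Rmult_1_r, Cmod_R.
    unfold Rdiv. rewrite !Rabs_mult, Rabs_inv, (Rabs_pos_eq PI), (Rabs_pos_eq (sqrt x)) by lra.
    replace (Rabs (sg up)) with 1; [ring |].
    destruct up; simpl sg; unfold Rabs; destruct (Rcase_abs _); lra. }
  assert (E5 : 5 <= exp (Lx Nt x)).
  { eapply Rle_trans; [apply exp_2_ge | now apply exp_le_compat]. }
  (* Equivalent to [exp L >= 5]. *)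
  assert (D2 : / (exp (Lx Nt x) - 1) <= 5 / 4 * / exp (Lx Nt x)).
  { apply (Rmult_le_reg_l (exp (Lx Nt x) - 1)); [lra |].
    rewrite Rinv_r by lra. apply (Rmult_le_reg_r (exp (Lx Nt x))); [lra |].
    replace ((exp (Lx Nt x) - 1) * (5 / 4 * / exp (Lx Nt x)) * exp (Lx Nt x))
      with ((exp (Lx Nt x) - 1) * (5 / 4)) by (field; lra). lra. }
  rewrite Cmod_mult, R.
  eapply Rle_trans.
  { apply Rmult_le_compat_l; [left; apply Rdiv_lt_0_compat; lra |].
    eapply Rle_trans; [exact D | exact D2]. }
  rewrite exp_Lx_mult by exact Hx. rewrite exp_Ropp.
  assert (P := exp_pos (Tt Nt)). right. field. lra.
Qed.

(** At the right end [sqrt (4 T^2 + 1) >= 2 T], so [atan Y] misses [PI / 2] by [atan (1 / Y)], and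
    [sqrt x / Y <= exp (- T)]. At the left end [sqrt x * y = exp (1 - T) <= 3 exp (- T)]. The factor
    [2 / PI <= 2 / 3] turns the sum [4] into [8 / 3]. *)
Lemma fprim_close Nt x : 0 < x <= 1 ->
  Rabs (fprim Nt x (4 * Tt Nt ^ 2 + 1) - fprim Nt x 1 - sqrt x) <= 8 / 3 * exp (- Tt Nt).
Proof.
  intros [Hx Hx1]. assert (PI0 := PI_RGT_0). assert (PI3 := PI2_3_2).
  assert (Hs := sqrt_lt_R0 x Hx). assert (HT := Tt_ge_0 Nt).
  assert (Es : sqrt x * sqrt x = x) by (apply sqrt_sqrt; lra).
  unfold fprim. rewrite sqrt_1. set (q := sqrt (4 * Tt Nt ^ 2 + 1)). set (s := sqrt x) in *.
  set (T := Tt Nt) in *.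
  assert (Hq : 2 * T <= q).
  { unfold q. rewrite <- (sqrt_Rsqr (2 * T)) by lra.
    apply sqrt_le_1_alt. unfold Rsqr. nra. }
  assert (HY := Rdiv_lt_0_compat _ _ (exp_pos (q - T)) Hs).
  assert (Hy := Rdiv_lt_0_compat _ _ (exp_pos (1 - T)) Hs).
  set (Y := exp (q - T) / s) in *. set (y := exp (1 - T) / s) in *.
  assert (EY := atan_inv Y HY).
  assert (A1 : 0 <= atan (/ Y) <= / Y).
  { assert (0 < / Y) by now apply Rinv_0_lt_compat. split.
    - rewrite <- atan_0. left. apply atan_increasing. lra.
    - apply atan_le_id. lra. }
  assert (A2 : 0 <= atan y <= y).
  { split; [rewrite <- atan_0; left; now apply atan_increasing | apply atan_le_id; lra]. }
  replace (s * (2 / PI) * atan Y - s * (2 / PI) * atan y - s)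
    with (- (2 / PI * (s * (atan (/ Y) + atan y)))) by (rewrite EY; field; lra).
  assert (P2 : 0 < 2 / PI <= 2 / 3).
  { split; [apply Rdiv_lt_0_compat; lra |].
    apply Rmult_le_compat_l; [lra |]. apply Rinv_le_contravar; lra. }
  assert (B1 : s * / Y <= exp (- T)).
  { unfold Y. replace (s * / (exp (q - T) / s)) with (s * s * / exp (q - T)).
    - rewrite Es, <- exp_Ropp.
      assert (exp (- (q - T)) <= exp (- T)) by (apply exp_le_compat; lra).
      generalize (exp_pos (- (q - T))). nra.
    - field. split; [lra | apply Rgt_not_eq, exp_pos]. }
  assert (B2 : s * y <= 3 * exp (- T)).
  { unfold y. replace (s * (exp (1 - T) / s)) with (exp (1 - T)) by (field; lra).
    unfold Rminus. rewrite exp_plus. apply Rmult_le_compat_r; [left; apply exp_pos |].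
    apply exp_le_3. }
  assert (B3 : 0 <= s * (atan (/ Y) + atan y) <= 4 * exp (- T)) by nra.
  rewrite Rabs_Ropp, Rabs_pos_eq by nra.
  replace (8 / 3 * exp (- T)) with (2 / 3 * (4 * exp (- T))) by field.
  apply Rmult_le_compat; lra.
Qed.

Lemma r_t_close_large Nt x : 0 < x <= 1 -> 2 <= Lx Nt x ->
  Cmod (Gamma_integral Nt x) < 12 * exp (- Tt Nt) ->
  Rabs (r_t Nt x - sqrt x) < 20 * exp (- Tt Nt).
Proof.
  intros Hx HL HG. assert (PI0 := PI_RGT_0). assert (P := exp_pos (- Tt Nt)).
  assert (EG := Gamma_integral_formula Nt x Hx HL).
  assert (R1 := Cmod_residue_term_le Nt x true (proj1 Hx) HL).
  assert (R2 := Cmod_residue_term_le Nt x false (proj1 Hx) HL).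
  assert (Cl := fprim_close Nt x Hx).
  set (D := fprim Nt x (4 * Tt Nt ^ 2 + 1) - fprim Nt x 1) in *.
  set (S := (resf x true * delta (upole Nt x true)
             + resf x false * delta (upole Nt x false))%C) in *.
  assert (HS : Cmod S <= 5 / 2 * exp (- Tt Nt) / PI).
  { eapply Rle_trans; [apply Cmod_triangle |]. lra. }
  assert (E : RtoC (D - r_t Nt x) = (Gamma_integral Nt x - 2 * PI * Ci * S)%C)
    by (rewrite EG; ring).
  assert (B : Rabs (D - r_t Nt x) < 17 * exp (- Tt Nt)).
  { rewrite <- Cmod_R, E. unfold Cminus.
    eapply Rle_lt_trans; [apply Cmod_triangle |].
    rewrite Cmod_opp, !Cmod_mult, Cmod_Ci, !Cmod_R, !Rabs_pos_eq by lra.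
    assert (2 * PI * 1 * Cmod S <= 5 * exp (- Tt Nt)).
    { replace (5 * exp (- Tt Nt)) with (2 * PI * 1 * (5 / 2 * exp (- Tt Nt) / PI))
        by (field; lra).
      apply Rmult_le_compat_l; lra. }
    lra. }
  replace (r_t Nt x - sqrt x) with (- (D - r_t Nt x) + (D - sqrt x)) by ring.
  eapply Rle_lt_trans; [apply Rabs_triang |]. rewrite Rabs_Ropp. lra.
Qed.

(** * Small [x]: direct estimate of the sum *)

Lemma sum_exp_sqrt_bound n : (1 <= n)%nat ->
  sum_n_m (fun j => h * exp (- sqrt (INR j * h)) / sqrt (INR j * h)) 1 n
  + 2 * exp (- sqrt (INR n * h)) <= (sqrt h + 2) * exp (- sqrt h).
Proof.
  intros Hn. assert (Hh := h_pos).
  (* The sum is compared with the integral of [exp (- sqrt t) / sqrt t], whose primitive is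
     [- 2 exp (- sqrt t)]. The extra summand on the left is the tail of that integral; it makes the
     induction close. *)
  induction Hn as [| n Hn IH].
  - rewrite sum_n_n. simpl INR. rewrite !Rmult_1_l.
    assert (Hs := sqrt_lt_R0 h ltac:(lra)).
    replace (h * exp (- sqrt h) / sqrt h) with (sqrt h * exp (- sqrt h)).
    + lra.
    + rewrite <- (sqrt_sqrt h) at 3 by lra. field. lra.
  - rewrite sum_n_Sm by lia. unfold plus; simpl plus.
    eapply Rle_trans; [| exact IH].
    assert (Pn : 1 <= INR n) by (apply (le_INR 1), Hn).
    assert (HA := sqrt_lt_R0 (INR n * h) ltac:(nra)).
    assert (HB := sqrt_lt_R0 (INR (S n) * h) ltac:(rewrite S_INR; nra)).
    assert (QA := sqrt_sqrt (INR n * h) ltac:(nra)).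
    assert (QB := sqrt_sqrt (INR (S n) * h) ltac:(rewrite S_INR; nra)).
    rewrite S_INR in QB at 3.
    set (a := sqrt (INR n * h)) in *. set (b := sqrt (INR (S n) * h)) in *.
    assert (Eh : h = (b - a) * (b + a)) by nra.
    assert (Hab : a < b) by nra.
    (* [e^-a - e^-b >= (b - a) e^-b] and [h = (b - a)(b + a) <= 2 b (b - a)] *)
    assert (E : (1 + (b - a)) * exp (- b) <= exp (- a)).
    { replace (- a) with ((b - a) + - b) by ring. rewrite exp_plus.
      apply Rmult_le_compat_r; [left; apply exp_pos | apply exp_ineq1_le]. }
    assert (Pb := exp_pos (- b)).
    assert (H2 : h * exp (- b) / b <= 2 * (b - a) * exp (- b)).
    { apply (Rmult_le_reg_r b); [exact HB |].
      replace (h * exp (- b) / b * b) with (h * exp (- b)) by (field; lra).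
      replace (2 * (b - a) * exp (- b) * b) with (2 * (b - a) * b * exp (- b)) by ring.
      apply Rmult_le_compat_r; nra. }
    change (sum_n_m (fun j => h * exp (- sqrt (INR j * h)) / sqrt (INR j * h)) 1 n
      + h * exp (- b) / b + 2 * exp (- b)
      <= sum_n_m (fun j => h * exp (- sqrt (INR j * h)) / sqrt (INR j * h)) 1 n
      + 2 * exp (- a)). lra.
Qed.

Lemma h_bounds : 16 < h < 25.
Proof. unfold h. generalize PI_sqr_lt PI2_3_2. nra. Qed.

(** From [4 <= sqrt h <= 5], the bound [(sqrt h + 2) * exp (- sqrt h)] is at most
    [7 * exp (- 4)]. *)
Lemma sum_exp_sqrt_le n :
  sum_n_m (fun j => h * exp (- sqrt (INR j * h)) / sqrt (INR j * h)) 1 n <= 7 * exp (- 4).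
Proof.
  assert (Hh := h_bounds). destruct n as [| n].
  - rewrite sum_n_m_zero by auto. unfold zero; simpl. generalize (exp_pos (- 4)). lra.
  - assert (B := sum_exp_sqrt_bound (S n) ltac:(lia)).
    assert (P := exp_pos (- sqrt (INR (S n) * h))).
    assert (S4 : 4 <= sqrt h).
    { rewrite <- (sqrt_Rsqr 4) by lra. apply sqrt_le_1_alt. unfold Rsqr. lra. }
    assert (S5 : sqrt h <= 5).
    { rewrite <- (sqrt_Rsqr 5) by lra. apply sqrt_le_1_alt. unfold Rsqr. lra. }
    assert (E : exp (- sqrt h) <= exp (- 4)).
    { apply exp_le_compat. lra. }
    generalize (exp_pos (- sqrt h)). nra.
Qed.

Lemma sum_n_m_nonneg (a : nat -> R) p q : (forall n, 0 <= a n) -> 0 <= sum_n_m a p q.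
Proof.
  intros H. replace 0 with (sum_n_m (fun _ => 0) p q).
  - apply sum_n_m_le. exact H.
  - exact (sum_n_m_const_zero p q).
Qed.

Lemma r_t_nonneg Nt x : 0 <= x -> 0 <= r_t Nt x.
Proof.
  intros Hx. unfold r_t. assert (Hh := h_pos). assert (PI0 := PI_RGT_0).
  apply Rmult_le_pos.
  - apply Rmult_le_pos; [nra | left; now apply Rinv_0_lt_compat].
  - apply sum_n_m_nonneg. intros j.
    apply Rmult_le_pos.
    (* Nonnegativity is asked at every index, so [j = 0] occurs; there the inverse takes its default
       value [0]. *)
    + destruct (Req_dec (sqrt (INR j * h)) 0) as [-> | N]; [rewrite Rinv_0; lra |].
      left. apply Rinv_0_lt_compat. generalize (sqrt_pos (INR j * h)). lra.
    + left. apply Rdiv_lt_0_compat; [apply exp_pos |].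
      generalize (exp_pos (2 * sqrt (INR j * h) - 2 * sqrt (INR Nt * h / 4))). lra.
Qed.

(** With [y = exp (sqrt (j h) - T)], dropping [x] from the denominator gives
    [y / (y^2 + x) <= 1 / y], and the factor [exp T] leaves the sum. *)
Lemma r_t_le_small Nt x : 0 <= x -> r_t Nt x <= x * exp (Tt Nt) / PI * (7 * exp (- 4)).
Proof.
  intros Hx. assert (Hh := h_pos). assert (PI0 := PI_RGT_0).
  eapply Rle_trans.
  2: { apply Rmult_le_compat_l; [| apply (sum_exp_sqrt_le Nt)].
       apply Rmult_le_pos; [| left; now apply Rinv_0_lt_compat].
       apply Rmult_le_pos; [exact Hx | left; apply exp_pos]. }
  unfold r_t. fold (Tt Nt). rewrite <- !(sum_n_m_mult_l (K := R_Ring)).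
  apply sum_n_m_le. intros j. unfold mult; simpl.
  set (b := sqrt (INR j * h)).
  assert (Hb : 0 <= / b).
  { destruct (Req_dec b 0) as [-> | N]; [rewrite Rinv_0; lra |].
    left. apply Rinv_0_lt_compat. generalize (sqrt_pos (INR j * h)). fold b. lra. }
  replace (2 * b - 2 * Tt Nt) with ((b - Tt Nt) + (b - Tt Nt)) by ring.
  rewrite exp_plus.
  replace (x * exp (Tt Nt) / PI * (h * exp (- b) / b))
    with (x * h / PI * (/ b * / exp (b - Tt Nt))).
  2: { rewrite <- exp_Ropp. replace (- (b - Tt Nt)) with (Tt Nt + - b) by ring.
       rewrite exp_plus. unfold Rdiv. ring. }
  assert (Y := exp_pos (b - Tt Nt)). set (y := exp (b - Tt Nt)) in *.
  apply Rmult_le_compat_l.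
  { apply Rmult_le_pos; [nra | left; now apply Rinv_0_lt_compat]. }
  apply Rmult_le_compat_l; [exact Hb |].
  assert (Y2 : 0 < y * y) by now apply Rmult_lt_0_compat.
  apply (Rmult_le_reg_r (y * (y * y + x))); [apply Rmult_lt_0_compat; lra |].
  replace (y / (y * y + x) * (y * (y * y + x))) with (y * y) by (field; lra).
  replace (/ y * (y * (y * y + x))) with (y * y + x) by (field; lra). lra.
Qed.

(** Both quantities are nonnegative, so the larger bound suffices. The factor [exp (- 4)] in the
    bound for [r_t] cancels the [exp 4] of the threshold and leaves [7 / 3 exp (- T)], while
    [sqrt x <= exp (2 - T) <= 9 exp (- T)]. *)
Lemma r_t_close_small Nt x : 0 <= x <= exp (4 - 2 * Tt Nt) ->
  Rabs (r_t Nt x - sqrt x) < 20 * exp (- Tt Nt).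
Proof.
  intros [Hx Hx1]. assert (PI0 := PI_RGT_0). assert (PI3 := PI2_3_2).
  set (T := Tt Nt) in *. assert (P := exp_pos (- T)).
  assert (B0 := r_t_nonneg Nt x Hx). assert (B1 := r_t_le_small Nt x Hx). fold T in B1.
  assert (S0 := sqrt_pos x).
  assert (S1 : sqrt x <= 9 * exp (- T)).
  { assert (E : exp (4 - 2 * T) = Rsqr (exp (2 - T)))
      by (unfold Rsqr; rewrite <- exp_plus; f_equal; ring).
    rewrite E in Hx1. apply sqrt_le_1_alt in Hx1.
    rewrite sqrt_Rsqr in Hx1 by (left; apply exp_pos).
    eapply Rle_trans; [exact Hx1 |].
    replace (2 - T) with (1 + 1 + - T) by ring. rewrite !exp_plus.
    apply Rmult_le_compat_r; [lra |]. generalize exp_le_3 (exp_pos 1). nra. }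
  assert (B2 : x * exp T / PI * (7 * exp (- 4)) <= 7 / 3 * exp (- T)).
  { replace (x * exp T / PI * (7 * exp (- 4))) with (7 * (x * (exp T * exp (- 4))) * / PI)
      by (unfold Rdiv; ring).
    replace (7 / 3 * exp (- T)) with (7 * (exp (4 - 2 * T) * (exp T * exp (- 4))) * / 3).
    2: { rewrite <- !exp_plus. replace (4 - 2 * T + (T + - 4)) with (- T) by ring. field. }
    assert (Q : 0 < exp T * exp (- 4)) by (apply Rmult_lt_0_compat; apply exp_pos).
    apply Rmult_le_compat.
    - nra.
    - left. now apply Rinv_0_lt_compat.
    - apply Rmult_le_compat_l; [lra |]. apply Rmult_le_compat_r; lra.
    - apply Rinv_le_contravar; lra. }
  apply Rabs_def1; lra.
Qed.

Theorem theorem2p1 :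
  (exists N0 : nat, forall Nt : nat, (N0 <= Nt)%nat ->
     forall x : R, exp (4 - 2 * Tt Nt) <= x <= 1 ->
       Cmod (Gamma_integral Nt x) < 12 * exp (- Tt Nt)) ->
  exists N0 : nat, forall Nt : nat, (N0 <= Nt)%nat ->
    forall x : R, 0 <= x <= 1 ->
      Rabs (r_t Nt x - sqrt x) < 20 * exp (- sqrt (INR Nt * h / 4)).
Proof.
  intros [N0 HN]. exists N0. intros Nt Hle x [Hx0 Hx1].
  change (sqrt (INR Nt * h / 4)) with (Tt Nt).
  (* The point [x = 0] falls into the second case, where no logarithm of [x] is taken. *)
  destruct (Rle_lt_dec (exp (4 - 2 * Tt Nt)) x) as [H | H].
  - assert (P := exp_pos (4 - 2 * Tt Nt)).
    apply r_t_close_large; [lra | | now apply HN].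
    assert (4 - 2 * Tt Nt <= ln x).
    { rewrite <- (ln_exp (4 - 2 * Tt Nt)). now apply ln_le. }
    unfold Lx. lra.
  - apply r_t_close_small. lra.
Qed.
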